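(* For any $\sigma$-pro-$p$-group $G$ the following conditions are equivalent: (a) $G$ is $\sigma$-isomorphic to $G_r$ for some $n\ge0$ and $r\in(F_n^-)^n$. (b) $\dim_{\mathbb F_p}H^2(G,\mathbb F_p)\le\dim_{\mathbb F_p}H^1(G,\mathbb F_p)<\infty$, and $\sigma$ acts by $-1$ on both spaces. Moreover, if these conditions hold, then (a) holds with $n=d_G$.
   Context: Fix a prime $p>2$ and a group $\{1,\sigma\}$ of order $2$. All homomorphisms of pro-$p$-groups are continuous, all subgroups are closed, and ''generated'' means topologically generated. A $\sigma$-pro-$p$-group is a pro-$p$-group $G$ with a continuous action of $\{1,\sigma\}$, written $a\mapsto{}^\sigma a$; $\sigma$-isomorphisms are the $\sigma$-equivariant topological isomorphisms. Put $G^-:=\{a\in G\mid {}^\sigma a=a^{-1}\}$. Cohomology $H^i(G,\mathbb F_p)$ is continuous cohomology with trivial coefficients, on which $\sigma$ acts via its action on $G$; $d_G:=\dim_{\mathbb F_p}H^1(G,\mathbb F_p)$ is the minimal number of generators of $G$. $F_n$ is the free pro-$p$-group on $x_1,\dots,x_n$, made a $\sigma$-pro-$p$-group by ${}^\sigma x_i=x_i^{-1}$. For $r=(r_1,\dots,r_n)\in(F_n^-)^n$ let $N_r$ be the ($\sigma$-invariant) normal subgroup of $F_n$ generated by all conjugates of $r_1,\dots,r_n$, and $G_r:=F_n/N_r$. *)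

(* Defs.v *)
From HB Require Import structures.
From mathcomp Require Import all_boot all_algebra.
From mathcomp Require Import all_classical all_reals all_analysis.

Set Implicit Arguments.
Unset Strict Implicit.
Unset Printing Implicit Defensive.

Import GRing.Theory.
Local Open Scope classical_set_scope.
Local Open Scope quotient_scope.

HB.mixin Record Group_isTopGroup G & Group G & Topological G := {
  mulg_continuous : continuous (fun x : G * G => (x.1 * x.2)%g);
  invg_continuous : continuous (fun x : G => (x^-1)%g)
}.

#[short(type="topGroupType")]
HB.structure Definition TopGroup :=
  {G of Group G & Topological G & Group_isTopGroup G}.

(* A continuous action of {1, sigma} by automorphisms is given by the
   automorphism by which sigma acts, whose square is the identity. *)
HB.mixin Record hasSigma G & TopGroup G := {
  sigma : G -> G;
  sigmaM : {morph sigma : x y / (x * y)%g};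
  sigmaK : involutive sigma;
  sigma_continuous : continuous sigma
}.

#[short(type="sigmaGroupType")]
HB.structure Definition SigmaGroup := {G of TopGroup G & hasSigma G}.

Section Subgroups.
Local Open Scope group_scope.

Definition is_subgroup (G : groupType) (H : set G) :=
  [/\ H 1, forall x y, H x -> H y -> H (x * y) & forall x, H x -> H x^-1].

Record normal_subgroup (G : groupType) := NormalSubgroup {
  nsub :> set G;
  nsub_group : is_subgroup nsub;
  nsub_conj : forall x g, nsub x -> nsub (x ^ g)
}.

Definition topgen (G : topGroupType) (A : set G) : set G :=
  \bigcap_(H in [set H | [/\ is_subgroup H, closed H & A `<=` H]]) H.

Definition conjugates (G : groupType) (I : Type) (r : I -> G) : set G :=
  [set x | exists i g, x = r i ^ g].

Lemma topgen_subgroup (G : topGroupType) (A : set G) : is_subgroup (topgen A).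
Proof.
split=> [H [[]] //|x y Ax Ay H HA|x Ax H HA].
  by have [[_ HM _] _ _] := HA; apply: HM; [apply: Ax | apply: Ay].
by have [[_ _ HV] _ _] := HA; apply: HV; apply: Ax.
Qed.

Lemma mulg_cont1 (G : topGroupType) (a b : G) :
  continuous (fun x : G => a * x * b).
Proof.
have mul_cvg (f h : G -> G) (x : G) : {for x, continuous f} ->
    {for x, continuous h} -> {for x, continuous (fun y => f y * h y)}.
  move=> fx hx; apply: (cvg_comp (fun y => (f y, h y)) (fun z => z.1 * z.2)).
    exact: (cvg_pair fx hx).
  exact: (mulg_continuous (f x, h x)).
move=> x; apply: (mul_cvg); last exact: cvg_cst.
by apply: mul_cvg; [exact: cvg_cst | exact: cvg_id].
Qed.

Lemma topgen_preimage (G : topGroupType) (A : set G) (f : G -> G) :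
  continuous f -> f 1 = 1 -> {morph f : x y / x * y} ->
  {morph f : x / x^-1} -> (forall x, A x -> topgen A (f x)) ->
  forall x, topgen A x -> topgen A (f x).
Proof.
move=> fc f1 fM fV fA x Ax H HA; have [[H1 HM HV] Hc sAH] := HA.
apply: (Ax (f @^-1` H)); split => /=.
- split=> /= [|y z Hy Hz|y Hy]; first by rewrite f1.
    by rewrite fM; exact: HM.
  by rewrite fV; exact: HV.
- by apply: preimage_closed => // y _; exact: fc.
- by move=> y Ay; exact: (fA _ Ay).
Qed.

Lemma topgen_conjugates_normal (G : topGroupType) (I : Type) (r : I -> G) x g :
  topgen (conjugates r) x -> topgen (conjugates r) (x ^ g).
Proof.
apply: (@topgen_preimage _ _ (fun x => x ^ g)) => [||u v|u|u [i [h ->]]].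
- by move=> u; under eq_fun do rewrite conjgE mulgA; exact: mulg_cont1.
- exact: conj1g.
- by rewrite conjMg.
- by rewrite conjVg.
- by move=> H [_ _]; apply; exists i, (h * g); rewrite conjgM.
Qed.

Definition normal_closure (G : topGroupType) (I : Type) (r : I -> G) :
    normal_subgroup G :=
  NormalSubgroup (topgen_subgroup (conjugates r))
    (@topgen_conjugates_normal G I r).

End Subgroups.

Section NormalSubgroupTheory.
Local Open Scope group_scope.
Variables (G : groupType) (N : normal_subgroup G).

Lemma nsub1 : nsub N 1. Proof. by case: (nsub_group N). Qed.

Lemma nsubM x y : nsub N x -> nsub N y -> nsub N (x * y).
Proof. by case: (nsub_group N) => _ NM _; exact: NM. Qed.

Lemma nsubV x : nsub N x -> nsub N x^-1.
Proof. by case: (nsub_group N) => _ _; apply. Qed.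

End NormalSubgroupTheory.

Section Quotient.
Local Open Scope group_scope.
Variables (G : topGroupType) (N : normal_subgroup G).

Definition cosetr : rel G := fun x y => `[< nsub N (x^-1 * y) >].

Lemma cosetr_equiv : equiv_class_of cosetr.
Proof.
split=> [x|x y|y x z]; rewrite /cosetr.
- by apply/asboolP; rewrite mulVg; exact: nsub1.
- by apply: asbool_equiv_eq; split=> /nsubV; rewrite invgM invgK.
- move=> /asboolP Nxy /asboolP Nyz; apply/asboolP.
  by rewrite -[z](mulVKg y) mulgA; exact: nsubM.
Qed.

Canonical cosetr_equiv_rel := EquivRelPack cosetr_equiv.
Canonical cosetr_encModRel := defaultEncModRel cosetr.

Definition quotg : Type := quotient_topology {eq_quot cosetr}.
HB.instance Definition _ := Topological.on quotg.
HB.instance Definition _ := Quotient.on quotg.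

Definition pig (x : G) : quotg := \pi_quotg x.

Lemma pigP x y : pig x = pig y <-> nsub N (x^-1 * y).
Proof.
split=> [/eqP|Nxy].
  by rewrite /pig; move/eqP => /eqquotP /asboolP.
by apply/eqquotP/asboolP.
Qed.

Definition oneq : quotg := pig 1.
Definition invq (a : quotg) : quotg := pig (repr a)^-1.
Definition mulq (a b : quotg) : quotg := pig (repr a * repr b).

Lemma pigK : cancel (repr : quotg -> G) pig.
Proof. by move=> a; exact: reprK. Qed.

Lemma repr_pig x : nsub N ((repr (pig x))^-1 * x).
Proof. by apply/pigP; rewrite pigK. Qed.

Lemma pigV x : invq (pig x) = pig x^-1.
Proof.
apply/pigP; rewrite invgK.
have := nsub_conj x^-1 (repr_pig x).
by rewrite conjgE invgK mulgK => /nsubV; rewrite invgM invgK.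
Qed.

Lemma pigM x y : mulq (pig x) (pig y) = pig (x * y).
Proof.
apply/pigP; rewrite invgM.
have Nx := nsub_conj y (repr_pig x).
have := nsubM (repr_pig y) Nx.
by rewrite conjgE !mulgA mulgK.
Qed.

Lemma mulqA : associative mulq.
Proof.
by move=> a b c; rewrite -[a]pigK -[b]pigK -[c]pigK !pigM mulgA.
Qed.
Lemma mul1q : left_id oneq mulq.
Proof. by move=> a; rewrite -[a]pigK pigM mul1g. Qed.
Lemma mulq1 : right_id oneq mulq.
Proof. by move=> a; rewrite -[a]pigK pigM mulg1. Qed.
Lemma mulVq : left_inverse oneq invq mulq.
Proof. by move=> a; rewrite -[a]pigK pigV pigM mulVg. Qed.
Lemma mulqV : right_inverse oneq invq mulq.
Proof. by move=> a; rewrite -[a]pigK pigV pigM mulgV. Qed.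

HB.instance Definition _ :=
  isGroup.Build quotg mulqA mul1q mulq1 mulVq mulqV.

Lemma pig_continuous : continuous pig.
Proof. exact: pi_continuous. Qed.

Lemma quotg_continuous (Z : topologicalType) (f : quotg -> Z) :
  continuous (f \o pig) -> continuous f.
Proof. by move=> fc; apply/quotient_continuous. Qed.

Lemma pig_open (U : set G) : open U -> open (pig @` U).
Proof.
move=> Uo; rewrite (_ : open _ = open (pig @^-1` (pig @` U))) //.
rewrite (_ : _ @^-1` _ = \bigcup_(n in nsub N) ((fun y => 1 * y * n) @^-1` U)).
  apply: bigcup_open => n _.
  by have /continuousP/(_ U Uo) := @mulg_cont1 G 1 n.
apply/seteqP; split=> [y [u Uu /pigP Nuy]|y [n Nn /= Uyn]].
  exists (u^-1 * y)^-1; first exact: nsubV.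
  by rewrite /= mul1g invgM invgK mulVKg.
exists (1 * y * n) => //; apply/pigP.
by rewrite mul1g invgM mulgVK; exact: nsubV.
Qed.

Lemma pig_nbhs x (A : set G) : nbhs x A -> nbhs (pig x) (pig @` A).
Proof.
rewrite !nbhsE => -[B [Bo Bx] sBA]; exists (pig @` B); last exact: image_subset.
by split; [exact: pig_open | exists x].
Qed.

Lemma mulq_continuous : continuous (fun x : quotg * quotg => x.1 * x.2).
Proof.
move=> [a b]; rewrite -[a]pigK -[b]pigK.
move: (repr a) (repr b) => x y W /=.
rewrite (_ : pig x * pig y = pig (x * y)); last exact: pigM.
move=> /pig_continuous /(mulg_continuous (x, y)) [[P Q] /= [Px Qy] sPQ].
exists (pig @` P, pig @` Q); first by split; exact: pig_nbhs.
move=> [_ _] /= [[u Pu <-] [v Qv <-]].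
by have := sPQ (u, v) (conj Pu Qv); rewrite /= -pigM.
Qed.

Lemma invq_continuous : continuous (fun x : quotg => x^-1).
Proof.
apply: quotg_continuous.
rewrite (_ : _ \o _ = pig \o (fun x => x^-1)).
  move=> x; apply: continuous_comp; first exact: invg_continuous.
  exact: pig_continuous.
by apply/funext => x; exact: pigV.
Qed.

HB.instance Definition _ :=
  Group_isTopGroup.Build quotg mulq_continuous invq_continuous.

End Quotient.

Record sigma_normal_subgroup (G : sigmaGroupType) := SigmaNormalSubgroup {
  snsub :> normal_subgroup G;
  snsub_sigma : forall x, nsub snsub x -> nsub snsub (sigma x)
}.

Section SigmaQuotient.
Local Open Scope group_scope.
Variables (G : sigmaGroupType) (N : sigma_normal_subgroup G).

Definition squotg : Type := quotg N.
HB.instance Definition _ := TopGroup.on squotg.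

Definition sigmaq (a : squotg) : squotg := pig N (sigma (repr (a : quotg N))).

Lemma sigma1 : sigma (1 : G) = 1.
Proof. by apply: (mulgI (sigma 1)); rewrite -sigmaM !mulg1. Qed.

Lemma sigmaV (x : G) : sigma x^-1 = (sigma x)^-1.
Proof. by apply: (mulgI (sigma x)); rewrite -sigmaM !mulgV sigma1. Qed.

Lemma sigmaq_pig x : sigmaq (pig N x) = pig N (sigma x).
Proof.
by apply/pigP; rewrite -sigmaV -sigmaM; apply: snsub_sigma; exact: repr_pig.
Qed.

Lemma sigmaqM : {morph sigmaq : x y / x * y}.
Proof.
move=> a b; rewrite -[a](@pigK _ N) -[b](@pigK _ N).
move: (repr _) (repr _) => x y.
have pigMs u v : (pig N u : squotg) * pig N v = pig N (u * v) by exact: pigM.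
by rewrite pigMs !sigmaq_pig pigMs sigmaM.
Qed.

Lemma sigmaqK : involutive sigmaq.
Proof. by move=> a; rewrite -[a](@pigK _ N) !sigmaq_pig sigmaK. Qed.

Lemma sigmaq_continuous : continuous sigmaq.
Proof.
apply: quotg_continuous; rewrite (_ : _ \o _ = pig N \o sigma).
  move=> x; apply: continuous_comp; first exact: sigma_continuous.
  exact: pig_continuous.
by apply/funext => x; exact: sigmaq_pig.
Qed.

HB.instance Definition _ :=
  hasSigma.Build squotg sigmaqM sigmaqK sigmaq_continuous.

End SigmaQuotient.

Section Presentation.
Local Open Scope group_scope.

(* G^- *)
Definition minus_part (G : sigmaGroupType) : set G :=
  [set a | sigma a = a^-1].

Variables (F : sigmaGroupType) (n : nat) (r : 'I_n -> F).
Variable r_minus : forall i, minus_part (r i).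

Lemma normal_closure_sigma x :
  nsub (normal_closure r) x -> nsub (normal_closure r) (sigma x).
Proof.
apply: topgen_preimage; [exact: sigma_continuous|exact: sigma1|exact: sigmaM|
  exact: sigmaV|].
move=> _ [i [g ->]]; rewrite conjgE !sigmaM sigmaV r_minus.
have [_ _ NV] := topgen_subgroup (conjugates r).
rewrite -[_ * _]invgK; apply: NV => H [_ _]; apply; exists i, (sigma g).
by rewrite conjgE !invgM !invgK mulgA.
Qed.

Definition relN : sigma_normal_subgroup F :=
  SigmaNormalSubgroup normal_closure_sigma.

(* G_r *)
Definition relG : sigmaGroupType := squotg relN.

End Presentation.

Definition sigma_iso (G H : sigmaGroupType) : Prop :=
  exists (f : G -> H) (g : H -> G),
    [/\ cancel f g, cancel g f, continuous f & continuous g] /\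
    ({morph f : x y / (x * y)%g} /\ {morph f : x / sigma x}).

Definition pro_p (p : nat) (G : topGroupType) : Prop :=
  [/\ compact [set: G], hausdorff_space G, totally_disconnected [set: G] &
    forall N : normal_subgroup G, open (nsub N) ->
      exists k : nat, ([set: quotg N] #= `I_(p ^ k))%card].

Definition free_pro_p (p n : nat) (F : topGroupType) (x : 'I_n -> F) : Prop :=
  pro_p p F /\
  forall (H : topGroupType) (h : 'I_n -> H), pro_p p H ->
    exists! f : F -> H,
      [/\ continuous f, {morph f : a b / (a * b)%g} &
          forall i, f (x i) = h i].

Definition sigma_presented (p n : nat) (G : sigmaGroupType) : Prop :=
  exists (F : sigmaGroupType) (x : 'I_n -> F),
    [/\ free_pro_p p x, forall i, sigma (x i) = ((x i)^-1)%g &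
      exists (r : 'I_n -> F) (r_minus : forall i, minus_part (r i)),
        sigma_iso G (relG r_minus)].

Section LmodQuotient.
Local Open Scope ring_scope.
Variables (K : pzRingType) (V : lmodType K).

Record submodule := Submodule {
  smod :> set V;
  smodP : smod 0 /\ forall (a : K) u v, smod u -> smod v -> smod (a *: u + v)
}.

Variable U : submodule.

Definition in_smod : {pred V} := fun v => `[< smod U v >].

Lemma in_smod_closed : submod_closed in_smod.
Proof.
have [U0 UD] := smodP U; split=> [|a u v]; first exact/asboolP.
by move=> /asboolP Uu /asboolP Uv; apply/asboolP; exact: UD.
Qed.

HB.instance Definition _ := GRing.isSubmodClosed.Build K V in_smod in_smod_closed.

Record smod_type := SmodType { smod_val : V; smod_valP : smod_val \in in_smod }.

HB.instance Definition _ := [isSub for smod_val].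
HB.instance Definition _ := [Choice of smod_type by <:].
HB.instance Definition _ := [SubChoice_isSubLmodule of smod_type by <:].

Definition lquot : Type := ring_quotient.Quotient.quot in_smod.
HB.instance Definition _ := GRing.Zmodule.on lquot.
HB.instance Definition _ := Quotient.on lquot.

Definition lpi (v : V) : lquot := \pi_lquot v.

Definition lscale (a : K) (u : lquot) : lquot := lpi (a *: repr u).

Lemma lpiK : cancel (repr : lquot -> V) lpi.
Proof. by move=> u; exact: reprK. Qed.

Lemma lpiP u v : lpi u = lpi v <-> smod U (u - v).
Proof.
have E : (u - v \in in_smod) = (lpi u == lpi v).
  exact: ring_quotient.Quotient.idealrBE.
split=> [/eqP|Uuv]; first by rewrite -E => /asboolP.
by apply/eqP; rewrite -E; apply/asboolP.
Qed.

Lemma lpiD u v : lpi (u + v) = lpi u + lpi v.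
Proof. exact: (ring_quotient.Quotient.pi_add in_smod). Qed.

Lemma lpiZ a v : lscale a (lpi v) = lpi (a *: v).
Proof.
apply/lpiP; rewrite -scalerBr -[_ *: _]addr0.
have [U0 UD] := smodP U; apply: UD => //.
by apply/lpiP; rewrite lpiK.
Qed.

Lemma lscaleA a b u : lscale a (lscale b u) = lscale (a * b) u.
Proof. by rewrite -[u]lpiK !lpiZ scalerA. Qed.
Lemma lscale1 : left_id 1 lscale.
Proof. by move=> u; rewrite -[u]lpiK lpiZ scale1r. Qed.
Lemma lscaleDr : right_distributive lscale +%R.
Proof.
by move=> a u v; rewrite -[u]lpiK -[v]lpiK -lpiD !lpiZ -lpiD scalerDr.
Qed.
Lemma lscaleDl u : {morph lscale^~ u : a b / a + b}.
Proof. by move=> a b; rewrite -[u]lpiK !lpiZ -lpiD scalerDl. Qed.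

HB.instance Definition _ :=
  GRing.Zmodule_isLmodule.Build K lquot lscaleA lscale1 lscaleDr lscaleDl.

End LmodQuotient.

Section Dimension.
Local Open Scope ring_scope.
Variables (K : fieldType) (V : lmodType K).

Definition has_dim (n : nat) : Prop :=
  exists f : {linear V -> 'rV[K]_n}, bijective f.

Definition finite_dim : Prop := exists n, has_dim n.

(* the junk value 0 is taken when V is not finite-dimensional *)
Definition dim : nat := xget 0%N [set n | has_dim n].

End Dimension.

Section Cohomology.
Local Open Scope ring_scope.
Variables (p : nat) (G : topGroupType).

Definition cfun (n : nat) : Type := ('I_n -> G) -> ('F_p)^o.
HB.instance Definition _ n := GRing.Lmodule.on (cfun n).

Definition continuous_cfun n (f : cfun n) : Prop :=
  continuous (f : {ptws 'I_n -> G} -> discrete_topology 'F_p).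

(* The i-th face (g_1, .., g_i * g_(i+1), .., g_(n+1)) for 0 < i < n+1; the
   first (resp. last) face drops g_1 (resp. g_(n+1)). Indices of g are shifted
   by one since 'I_n starts at 0. *)
Definition face n (i : 'I_n.+2) (g : 'I_n.+1 -> G) : 'I_n -> G :=
  fun j => if (j.+1 < i)%N then g (widen_ord (leqnSn n) j)
           else if j.+1 == i then (g (widen_ord (leqnSn n) j) * g (lift ord0 j))%g
           else g (lift ord0 j).

Definition coboundary n (f : cfun n) : cfun n.+1 :=
  fun g => \sum_(i < n.+2) (-1) ^+ i * f (face i g).

Lemma continuous_cfunP n (f : cfun n) : continuous_cfun f <->
  forall g : {ptws 'I_n -> G}, \forall h \near g, f h = f g.
Proof.
split=> [fc g|fc g A].
  have := fc g [set f g]; apply.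
  by rewrite nbhs_principalE; exact/principal_filterP.
rewrite nbhs_principalE => /principal_filterP Afg.
by apply: (@filterS _ _ (@nbhs_filter {ptws 'I_n -> G} g)) (fc g) => h /= ->.
Qed.

Lemma continuous_cfun0 n : continuous_cfun (0 : cfun n).
Proof.
apply/continuous_cfunP => g.
by apply: (@filterE _ _ (@nbhs_filter {ptws 'I_n -> G} g)).
Qed.

Lemma continuous_cfunD n (a : 'F_p) (f h : cfun n) :
  continuous_cfun f -> continuous_cfun h -> continuous_cfun (a *: f + h).
Proof.
move=> /continuous_cfunP fc /continuous_cfunP hc; apply/continuous_cfunP => g.
have := @filterI _ _ (@nbhs_filter {ptws 'I_n -> G} g) _ _ (fc g) (hc g).
apply: (@filterS _ _ (@nbhs_filter {ptws 'I_n -> G} g)) => k [fk hk].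
by rewrite /GRing.add/= /GRing.scale/= fk hk.
Qed.

Lemma coboundary0 n : coboundary (0 : cfun n) = 0.
Proof. by apply/funext => g; apply: big1 => i _; rewrite mulr0. Qed.

Lemma coboundaryD n (a : 'F_p) (f h : cfun n) :
  coboundary (a *: f + h) = a *: coboundary f + coboundary h.
Proof.
apply/funext => g.
rewrite [RHS](_ : _ = a * coboundary f g + coboundary h g) //.
rewrite /coboundary mulr_sumr -big_split; apply: eq_bigr => i _ /=.
rewrite [X in _ * X](_ : _ = a * f (face i g) + h (face i g)) //.
by rewrite mulrDr mulrCA.
Qed.

Lemma cocycles_subproof n :
  let Z := [set f : cfun n | continuous_cfun f /\ coboundary f = 0] in
  Z 0 /\ forall (a : 'F_p) f h, Z f -> Z h -> Z (a *: f + h).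
Proof.
split=> [|a f h [fc f0] [hc h0]].
  by split; [exact: continuous_cfun0 | exact: coboundary0].
by split; [exact: continuous_cfunD | rewrite coboundaryD f0 h0 scaler0 addr0].
Qed.

Definition cocycles n : submodule (cfun n) := Submodule (@cocycles_subproof n).

(* B^n as a subset of the type of n-cocycles, with B^0 = 0 *)
Definition coboundaries_set n : set (smod_type (cocycles n)) :=
  match n with
  | 0 => [set 0]
  | m.+1 => [set z : smod_type (cocycles m.+1) | exists f : cfun m,
                continuous_cfun f /\ smod_val z = coboundary f]
  end.

Lemma coboundaries_subproof n :
  let B := @coboundaries_set n in
  B 0 /\ forall (a : 'F_p) f h, B f -> B h -> B (a *: f + h).
Proof.
case: n => [|n]; first by split=> // a f h -> ->; rewrite scaler0 addr0.
split=> [|a u v [f [fc ef]] [h [hc eh]]].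
  by exists 0; split; [exact: continuous_cfun0 | rewrite coboundary0].
exists (a *: f + h); split; first exact: continuous_cfunD.
by rewrite coboundaryD -ef -eh.
Qed.

Definition coboundaries n : submodule (smod_type (cocycles n)) :=
  Submodule (@coboundaries_subproof n).

(* H^n(G, F_p) *)
Definition cohom n : lmodType 'F_p := lquot (coboundaries n).

End Cohomology.

Section SigmaAction.
Local Open Scope ring_scope.
Variables (p : nat) (G : sigmaGroupType).

(* f |-> f o sigma^-1, where sigma^-1 = sigma *)
Definition sigma_cfun n (f : cfun p G n) : cfun p G n := fun g => f (sigma \o g).

Lemma sigma_ptws_continuous n :
  continuous (fun g : {ptws 'I_n -> G} => (sigma \o g : {ptws 'I_n -> G})).
Proof.
move=> g; have FF := fmap_filter
  (fun g : {ptws 'I_n -> G} => (sigma \o g : {ptws 'I_n -> G})) (nbhs_filter g).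
apply/cvg_sup => i; apply/cvg_image.
  by rewrite -subTset => y _; exists (fun=> y).
move=> A Ai; exists ((fun h : 'I_n -> G => h i) @^-1` A).
  have sA : nbhs (g i) (sigma @^-1` A) by exact: sigma_continuous Ai.
  exact: (@proj_continuous _ (fun _ : 'I_n => G) i g _ sA).
by rewrite image_preimage// -subTset => y _; exists (fun=> y).
Qed.

Lemma sigma_continuous_cfun n (f : cfun p G n) :
  continuous_cfun f -> continuous_cfun (sigma_cfun f).
Proof.
move=> fc g; apply: (@continuous_comp _ _ _
  (fun g : {ptws 'I_n -> G} => (sigma \o g : {ptws 'I_n -> G}))).
  exact: sigma_ptws_continuous.
exact: fc.
Qed.

Lemma sigma_coboundary n (f : cfun p G n) :
  sigma_cfun (coboundary f) = coboundary (sigma_cfun f).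
Proof.
apply/funext => g; apply: eq_bigr => i _; congr (_ * f _); apply/funext => j.
by rewrite /face /=; case: ifP => // _; case: ifP => // _; rewrite sigmaM.
Qed.

Lemma sigma_cocycle n (z : smod_type (cocycles p G n)) :
  sigma_cfun (smod_val z) \in in_smod (cocycles p G n).
Proof.
have /asboolP [zc z0] := smod_valP z; apply/asboolP; split.
  exact: sigma_continuous_cfun.
by rewrite -sigma_coboundary z0.
Qed.

Definition sigma_cohom n (c : cohom p G n) : cohom p G n :=
  lpi (coboundaries p G n) (SmodType (sigma_cocycle (repr c))).

Lemma sigma_cohom_pi n (z : smod_type (cocycles p G n)) :
  sigma_cohom (lpi (coboundaries p G n) z) =
  lpi (coboundaries p G n) (SmodType (sigma_cocycle z)).
Proof.
apply/lpiP.
have /lpiP : lpi (coboundaries p G n) (repr (lpi (coboundaries p G n) z)) =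
    lpi (coboundaries p G n) z by exact: lpiK.
move: (repr _) => y; case: n z y => [|n] z y /=.
  by move=> /eqP; rewrite subr_eq0 => /eqP ->; rewrite subrr.
move=> [f [fc ef]]; exists (sigma_cfun f); split.
  exact: sigma_continuous_cfun.
by rewrite -sigma_coboundary -ef.
Qed.

End SigmaAction.

Section Conditions.
Variables (p : nat) (G : sigmaGroupType).

Definition d_G : nat := dim (cohom p G 1).

Definition sigma_acts_by_opp n : Prop :=
  forall c : cohom p G n, sigma_cohom c = (- c)%R.

Definition cohom_condition : Prop :=
  [/\ finite_dim (cohom p G 1), finite_dim (cohom p G 2),
      (dim (cohom p G 2) <= dim (cohom p G 1))%N,
      sigma_acts_by_opp 1 & sigma_acts_by_opp 2].

End Conditions.

(* Main.v *)
(* The five-term sequence of 1 -> N -> F -> G -> 1 in explicit cochains.  A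
   locally constant b : F -> F_p with b(xn) = b(x) + b(n) and
   b(nx) = b(n) + b(x) for n in N has a coboundary that factors through G, and
   b is trivial on N as soon as this cocycle of G is a coboundary, modulo
   characters of F.

   From a presentation: every cocycle of G becomes on F the coboundary of such
   a b, since F is free and the extension of F by F_p defined by the cocycle is
   pro-p; b restricted to N is determined by the values b(r_j).  If A is the
   matrix of the values at the r_j of the characters dual to the x_i, then
   H^1(G) is the kernel of A and H^2(G) embeds into F_p^n modulo the row space
   of A.  The involution inverts the x_i and the r_j, hence acts by -1.

   Conversely, if sigma acts by -1, then f(g sigma(g)^-1) = 2 f(g) for all
   characters f, so generators may be chosen in G^-; in the same way generators
   n_j of N, detected by H^2(G), may be replaced by n_j sigma(n_j)^-1. *)
Require Import Defs.
From HB Require Import structures.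
From mathcomp Require Import all_boot all_algebra all_fingroup all_solvable.
From mathcomp Require Import all_classical all_reals all_analysis.
From mathcomp Require Import finmap ring.

Set Implicit Arguments.
Unset Strict Implicit.
Unset Printing Implicit Defensive.

Import GRing.Theory.
Local Open Scope ring_scope.

(** The two conditions on [b] make its restriction to N a homomorphism invariant under conjugation.
    Carrying an extension of it to the whole group turns the five-term sequence into computations
    with functions on F. The bound on H^2 comes from a single square matrix A: its kernel and its
    cokernel both have dimension n - rank A, which is where having as many relators as generators
    matters. In the converse the crux is that transgression is injective on invariant characters of
    N. With n = d_G, every character of F is inflated from G, so an invariant character of N with
    trivial class must vanish. Hence at most dim H^2 points of N detect all of them, and the spare
    relators are taken to be 1. Oddness of p enters when 2 b(g) = 0 has to give b(g) = 0. Two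
    supplies are needed: enough functions [b], which come from the centrality of normal subgroups of
    order p in finite p-groups, and an actual free pro-p-group with involution, since F is specified
    only by its universal property. *)

Definition additive_along (p : nat) (G : groupType) (N : set G) (b : G ->
  'F_p) :=
  (forall x n, N n -> b (x * n)%g = b x + b n) /\
  (forall x n, N n -> b (n * x)%g = b n + b x).

(** * Finite p-groups *)

Lemma morph_one (G H : groupType) (f : G -> H) :
  {morph f : x y / (x * y)%g} -> f 1%g = 1%g.
Proof. by move=> fM; apply: (mulgI (f 1%g)); rewrite -fM !mulg1. Qed.

Lemma morph_inv (G H : groupType) (f : G -> H) x :
  {morph f : x y / (x * y)%g} -> f x^-1%g = (f x)^-1%g.
Proof. by move=> fM; apply: (mulgI (f x)); rewrite -fM !mulgV morph_one. Qed.

Section FiniteGroups.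
Local Open Scope group_scope.

(** Coset representatives split every y as r(y) n with n in N, and [b] is the discrete logarithm of
    n. Right additivity is automatic; left additivity is centrality. *)
Lemma additive_along_central (p : nat) (gT : finGroupType) (N : {group gT}) :
    prime p -> #|N| = p -> (N \subset 'C([set: gT]%SET)) ->
  exists2 b : gT -> 'F_p, additive_along [set` N]%classic b &
    forall n, n \in N -> b n = 0%R -> n = 1.
Proof.
move=> pP oN cN; have /cyclicP[a Na] : cyclic N by rewrite prime_cyclic ?oN.
have oa : #[a] = p by rewrite -oN Na.
pose dlog y : 'F_p := (odflt (Ordinal (prime_gt0 pP)) [pick i :
  'I_p | (a ^+ i == y)%g])%:R%R.
have dlogE i : dlog (a ^+ i) = i%:R%R.
  rewrite /dlog; case: pickP =>
    [j|/(_ (Ordinal (ltn_pmod i (prime_gt0 pP))))] /=.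
    by rewrite eq_expg_mod_order oa => /eqP ij;
      rewrite -[LHS]Fp_nat_mod// ij Fp_nat_mod.
  by rewrite eq_expg_mod_order oa modn_mod eqxx.
have dlogM x y : x \in N -> y \in N -> dlog (x * y) = (dlog x + dlog y)%R.
  rewrite Na => /cyclePmin[i _ ->] /cyclePmin[j _ ->].
  by rewrite -expgD !dlogE natrD.
pose r y := fingroup.repr (y *: N).
have rN y : ((r y)^-1 * y) \in N.
  have : r y \in (y *: N) by apply: (mem_repr y); exact: lcoset_refl.
  by case/lcosetP => n Nn ->; rewrite invgM mulgKV groupV.
have rM y n : n \in N -> r (y * n) = r y by move=> Nn;
  rewrite /r lcosetM lcoset_id.
(* [fingroup.repr] returns 1 on any set containing 1, so on N itself [b] is the plain logarithm. *)
have r1 n : n \in N -> r n = 1.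
  by move=> Nn; rewrite /r lcoset_id // /fingroup.repr group1.
pose b y := dlog ((r y)^-1 * y).
have bM x n : n \in N -> b (x * n) = (b x + b n)%R.
  by move=> Nn; rewrite /b rM // (r1 n)// invg1 mul1g mulgA dlogM.
exists b; first split=> x n /= Nn.
- exact: bM.
- have -> : (n * x = x * n) by have /centP/(_ x) := fintype.subsetP cN _ Nn;
    apply.
  by rewrite bM // addrC.
- move=> n Nn; rewrite /b r1 // invg1 mul1g; move: Nn.
  rewrite Na => /cyclePmin[i ia ->]; rewrite dlogE => /(congr1 val) /=.
  by rewrite val_Fp_nat// modn_small ?oa// -?oa// => ->.
Qed.

(** Dividing out M and then a subgroup Q of index p in N / M that is normal in the whole quotient
    leaves an image of N of order p. Being normal in a p-group, it is central, and the function
    found there is pulled back. *)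
Lemma finite_additive_along (p : nat) (gT : finGroupType) (M N : {group gT}) :
    prime p -> pgroup p [set: gT]%SET -> normal M [set: gT]%SET ->
      normal N [set: gT]%SET ->
    M \proper N ->
  exists b : gT -> 'F_p, [/\ additive_along [set` N]%classic b,
    forall m, m \in M -> b m = 0%R & exists2 n, n \in N & b n != 0%R].
Proof.
move=> pP pT nM nN /andP[sMN nsNM].
have nMT x : x \in 'N(M) by rewrite (fintype.subsetP (normal_norm nM)) ?inE.
have nNM : normal (N / M) [set:
  coset_of M]%SET by rewrite -(quotientT M) quotient_normal.
have pNM : pgroup p [set:
  coset_of M]%SET by rewrite -(quotientT M) quotient_pgroup.
have oNM : (1 < #|N / M|)%N.
  rewrite cardG_gt1; apply: contra nsNM => /eqP NM1.
  by rewrite -quotient_sub1 ?NM1// (fintype.subset_trans _ (normal_norm nM))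
    ?finset.subsetT.
have pNM' : pgroup p (N / M) by apply: pgroupS pNM; exact: normal_sub.
have [k ok] := p_natP pNM'.
case: k ok => [ok|k ok]; first by rewrite ok in oNM.
have [|Q [sQN nQ oQ]] := normal_pgroup (r := k) pNM nNM;
  first by rewrite ok pfactorK.
have nQT x : x \in 'N(Q) by rewrite (fintype.subsetP (normal_norm nQ)) ?inE.
set N2 := (N / M / Q)%G.
have oN2 : #|N2| = p.
  rewrite card_quotient ?(fintype.subset_trans _ (normal_norm nQ))
    ?finset.subsetT //.
  by rewrite -divgS // ok oQ expnS mulnK // expn_gt0 prime_gt0.
have nN2 : normal N2 [set:
  coset_of Q]%SET by rewrite -(quotientT Q) quotient_normal.
have pN2 : pgroup p [set:
  coset_of Q]%SET by rewrite -(quotientT Q) quotient_pgroup.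
have [|b [bNr bNl] bI] := additive_along_central pP oN2.
  (* A nontrivial normal subgroup of a nilpotent group meets the centre, and one of prime order then
     lies inside it. *)
  have := meet_center_nil (pgroup_nil pN2) nN2.
  rewrite -cardG_gt1 oN2 prime_gt1 // => /(_ isT) nt.
  have /prime_meetG := nt; rewrite oN2 => /(_ pP) /fintype.subset_trans; apply.
  by rewrite finset.subsetIr.
pose f x := coset Q (coset M x).
have fM x y : f (x * y) = (f x * f y) by rewrite /f !morphM //= ?nQT ?nMT.
have fN n : n \in N -> f n \in N2 by move=> Nn; rewrite !mem_quotient.
have f1 m : m \in M -> f m = 1 by move=> Mm;
  rewrite /f (coset_id Mm) (morph1 (coset_morphism Q)).
have b1 : b 1 = 0%R.
  by have := bNr 1 1 (group1 N2); rewrite mul1g => /esym/(canRL (addrK _));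
    rewrite subrr.
exists (b \o f); split=> [|m Mm|].
- by split=> x n /= Nn; rewrite fM; [rewrite bNr|rewrite bNl] => //=; exact: fN.
- by rewrite /= f1.
- have /trivgPn[y N2y y1] : N2 :!=: 1 by rewrite -cardG_gt1 oN2 prime_gt1.
  have /morphimP[y' _ /morphimP[n _ Nn ->] yE] := N2y.
  by exists n => //=; rewrite -[f n]yE; apply: contra_neq y1; exact: bI.
Qed.

End FiniteGroups.

Local Open Scope classical_set_scope.

(** * Linear algebra *)

Section FiniteFieldDimension.
Variable K : finFieldType.

(** Over a finite field, counting vectors recovers the dimension. *)
Lemma has_dim_uniq (V : lmodType K) n m : has_dim V n -> has_dim V m -> n = m.
Proof.
move=> [f [f' fK f'K]] [g [g' gK g'K]].
have: #|{: 'rV[K]_n}| = #|{: 'rV[K]_m}|.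
  apply: (@bij_eq_card _ _ (g \o f')).
  by exists (f \o g') => x /=; rewrite (fK, gK) (f'K, g'K).
rewrite !card_mx !mul1n => /expnI; apply.
by rewrite ltnNge -ltnS; apply/negP => /(leq_ltn_trans (card_finNzRing_gt1 K)).
Qed.

Lemma dimE (V : lmodType K) n : has_dim V n -> Defs.dim V = n.
Proof.
by move=> Vn; apply: (@has_dim_uniq V) => //; exact:
  (@xgetPex _ 0%N (has_dim V)) (ex_intro _ n Vn).
Qed.

(** There are only finitely many vectors, so all those in [S] can serve as generators. *)
Lemma subspace_row n (S : set 'rV[K]_n) : S 0 ->
    (forall a u v, S u -> S v -> S (a *: u + v)) ->
  exists B : 'M[K]_n, forall u, (u <= B)%MS <-> S u.
Proof.
move=> S0 SD; exists (\sum_(u : 'rV[K]_n | `[< S u >]) <<u>>)%MS => u; split.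
  move=> /sub_sumsmxP [w ->].
  elim/big_ind: _ => // [x y Sx Sy|v /asboolP Sv];
    first by rewrite -[x]scale1r; exact: SD.
  have /sub_rVP [a ->] : (w v *m <<v>> <= v)%MS by rewrite
    (submx_trans (submxMl _ _)) ?genmxE.
  by rewrite -[_ *: _]addr0; exact: SD.
move=> Su; apply: (submx_trans (A := u) (B := <<u>>%MS));
  first by rewrite genmxE.
by apply: (sumsmx_sup u); first exact/asboolP.
Qed.

Lemma has_dim_image (V : lmodType K) n (f : {linear V -> 'rV[K]_n}) :
  injective f -> exists B : 'M[K]_n,
    (forall u, (u <= B)%MS <-> exists v, f v = u) /\ has_dim V (\rank B).
Proof.
move=> fI; have [||B BE] := @subspace_row n (range f).
- by exists 0; rewrite ?linear0.
- by move=> a _ _ [u _ <-] [v _ <-]; exists (a *: u + v); rewrite ?linearP.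
exists B; split=> [u|].
  by rewrite BE; split=> [[v _ <-]|[v <-]]; exists v.
pose g v := f v *m pinvmx (row_base B).
have gl : linear g by move=> a u v; rewrite /g linearP mulmxDl -scalemxAl.
pose gL := GRing.isLinear.Build K V 'rV[K]_(\rank B) *:%R g gl.
pose g' : {linear V -> 'rV[K]_(\rank B)} := HB.pack g gL.
have fB v : (f v <= row_base B)%MS by rewrite eq_row_base; apply/BE; exists v.
have hP (w : 'rV[K]_(\rank B)) : exists v, f v = w *m row_base B.
  have /BE [v _ <-] : (w *m row_base B <= B)%MS by rewrite
    (submx_trans (submxMl _ _))// eq_row_base.
  by exists v.
pose h w := sval (cid (hP w)).
have hE w : f (h w) = w *m row_base B by rewrite /h; case: cid.
exists g', h => [v|w] /=.
  by apply: fI; rewrite hE /g mulmxKpV.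
by rewrite /g hE mulmxKp ?row_base_free.
Qed.

End FiniteFieldDimension.

(** [W] may have infinite dimension; only its quotient by the functions vanishing on [N] is
    controlled, through [T]. Each new point cuts [W] down to the functions vanishing there and uses
    up one coordinate of [T]. The lemma produces both the generators of G and the relators. *)
Lemma separating_points (K : fieldType) (V : lmodType K) (X : Type)
    (e : X -> V -> K) (N : set X) m (W : set V) (T : V -> 'rV[K]_m) :
    (forall x a u v, e x (a *: u + v) = a * e x u + e x v) ->
    W 0 -> (forall a u v, W u -> W v -> W (a *: u + v)) ->
    (forall a u v, W u -> W v -> T (a *: u + v) = a *: T u + T v) ->
    (forall u, W u -> T u = 0 -> forall x, N x -> e x u = 0) ->
  exists s : seq X, [/\ (size s <= m)%N,
    (forall i x0, (i < size s)%N -> N (nth x0 s i)) &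
    forall u, W u -> (forall i x0, (i < size s)%N -> e (nth x0 s i) u = 0) ->
    forall x, N x -> e x u = 0].
Proof.
move=> eL; elim: m W T => [|m IH] W T W0 WD TD TI.
  exists [::]; split=> // u Wu _ x Nx.
  by apply: (TI _ Wu) => //; apply/rowP => -[].
have [W_0|] := pselect (forall u, W u -> forall x, N x -> e x u = 0).
  by exists [::]; split=> // u Wu _; exact: W_0.
move=> /existsNP [u0 /not_implyP
  [Wu0 /existsNP [x0 /not_implyP [Nx0 /eqP ex0]]]].
have : T u0 != 0 by apply: contra_neq ex0 => /TI; apply.
move=> /eqP /rowP /existsNP [k /eqP]; rewrite mxE => Tk.
pose T' u : 'rV[K]_m := col' k (T u - (T u 0 k / T u0 0 k) *: T u0).
have e0 x : e x 0 = 0.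
  by have := eL x 1 0 0; rewrite scale1r addr0 mul1r => /(canLR (addrK _));
    rewrite subrr.
have T0 : T 0 = 0.
  by have := TD 1 _ _ W0 W0; rewrite scale1r addr0 scale1r =>
    /(canLR (addrK _)); rewrite subrr.
have [||||s [sm sN sP]] := IH [set u | W u /\ e x0 u = 0] T'.
- by split.
- by move=> a u v [Wu eu] [Wv ev]; split;
    [exact: WD | rewrite eL eu ev mulr0 addr0].
- move=> a u v [Wu _] [Wv _]; rewrite /T' TD //; apply/rowP => j; rewrite !mxE.
  by ring.
- move=> u [Wu eu] Tu.
  set a := T u 0 k / T u0 0 k in Tu.
  have Tu' : T (- a *: u0 + u) = 0.
    rewrite TD // scaleNr addrC; apply/rowP => j; rewrite [RHS]mxE.
    case: (unliftP k j) => [i ->|->]; last by rewrite !mxE /a divfK ?subrr.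
    by have /rowP/(_ i) := Tu; rewrite !mxE.
  have Wu' : W (- a *: u0 + u) by exact: WD.
  have := TI _ Wu' Tu' _ Nx0; rewrite eL eu addr0 => /eqP.
  rewrite mulf_eq0 oppr_eq0 (negPf ex0) orbF => /eqP a0 x Nx.
  by have := TI _ Wu' Tu' _ Nx; rewrite eL a0 oppr0 mul0r add0r.
exists (x0 :: s); split=> // [[|i] y0 //=|u Wu us]; first by rewrite ltnS;
  exact: sN.
apply: sP; first by split=> //; exact: (us 0%N x0).
by move=> i y0 si; exact: (us i.+1 y0).
Qed.

(** * Cohomology in degrees one and two *)

Lemma prod_cvg (I : eqType) (K : I -> topologicalType) (T : Type)
    (F : set_system T) (h : T -> prod_topology K) (g : prod_topology K) :
  Filter F -> (forall i, (h t i) @[t --> F] --> g i) -> h @ F --> g.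
Proof.
move=> FF hc; have FhF := fmap_filter h FF.
apply/cvg_sup => i; apply/cvg_image.
  rewrite -subTset => y _; exists (@dfwith I K g i y) => //.
  by rewrite dfwithin.
move=> A Ai; exists ((fun f : prod_topology K => f i) @^-1` A); first exact:
  hc Ai.
by rewrite image_preimage// -subTset => y _; exists (@dfwith I K g i y);
  rewrite ?dfwithin.
Qed.

Lemma prod_continuous (I : eqType) (K : I -> topologicalType)
    (T : topologicalType) (h : T -> prod_topology K) :
  (forall i, continuous (fun t => h t i)) -> continuous h.
Proof. by move=> hc t; apply: prod_cvg => i; exact: hc. Qed.

(** Continuity into a discrete target, without putting a topology on [A]. *)
Definition loc_const (T : topologicalType) (A : Type) (f : T -> A) :=
  forall x, \forall y \near x, f y = f x.

Lemma loc_const_comp (S T : topologicalType) (A : Type) (f : T -> A)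
    (h : S -> T) :
  continuous h -> loc_const f -> loc_const (f \o h).
Proof. by move=> hc fl x; exact: hc (fl (h x)). Qed.

Lemma loc_const_map2 (T : topologicalType) (A B C : Type) (o : A -> B -> C)
    (f : T -> A) (g : T -> B) :
  loc_const f -> loc_const g -> loc_const (fun x => o (f x) (g x)).
Proof. by move=> fl gl x; near=> y; rewrite (near (fl x) y)// (near (gl x) y).
Unshelve. all: by end_near. Qed.

Lemma loc_const_cst (T : topologicalType) (A : Type) (a : A) :
    loc_const (fun _ : T => a).
Proof. by move=> x; near=> y. Unshelve. all: by end_near. Qed.

Section CohomologyClasses.
Variables (p : nat) (G : topGroupType) (n : nat).
Implicit Types f : cfun p G n.+1.

Local Notation Z := (smod (cocycles p G n.+1)).
Let B f := exists h : cfun p G n, continuous_cfun h /\ f = coboundary h.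

Lemma mem_cocycles f : Z f -> f \in in_smod (cocycles p G n.+1).
Proof. by move=> ?; exact/asboolP. Qed.

Lemma cocycles_mem f : f \in in_smod (cocycles p G n.+1) -> Z f.
Proof. by move/asboolP. Qed.

Definition coclass f (Zf : Z f) : cohom p G n.+1 :=
  lpi _ (SmodType (mem_cocycles Zf)).

Lemma coclass_surj (c : cohom p G n.+1) : exists f (Zf : Z f), c = coclass Zf.
Proof.
have := lpiK c; case: (generic_quotient.repr c : smod_type _) => f Zf <-.
by exists f, (cocycles_mem Zf); congr lpi; exact: val_inj.
Qed.

Lemma coclassP f h (Zf : Z f) (Zh : Z h) :
    coclass Zf = coclass Zh <-> B (f - h).
Proof. by rewrite /coclass lpiP. Qed.

Lemma coclassD a f h (Zf : Z f) (Zh : Z h) (Zfh : Z (a *: f + h)) :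
  coclass Zfh = a *: coclass Zf + coclass Zh.
Proof.
rewrite /coclass.
rewrite -[a *: lpi _ _]/(lscale _ _) lpiZ -lpiD; congr lpi; exact: val_inj.
Qed.

Lemma cocyclesD a f h : Z f -> Z h -> Z (a *: f + h).
Proof. by case: (smodP (cocycles p G n.+1)) => _; exact. Qed.

Lemma coclass0 (Z0 : Z 0) : coclass Z0 = 0.
Proof.
have := coclassD Z0 Z0 (cocyclesD 1 Z0 Z0); rewrite [1 *: coclass _]scale1r.
have -> : coclass (cocyclesD 1 Z0 Z0) = coclass Z0.
  apply/coclassP; exists 0; split; first exact: continuous_cfun0.
  by rewrite scale1r addr0 subrr coboundary0.
by move=> /esym/(canRL (addrK _)); rewrite subrr.
Qed.

(** Moves coordinates from the quotient space to a function on plain cochains, linear only on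
    cocycles and with junk value 0 elsewhere, so that later arguments never handle classes. *)
Lemma cohom_coordinates m : has_dim (cohom p G n.+1) m ->
  exists T : cfun p G n.+1 -> 'rV['F_p]_m,
    [/\ forall a f h, Z f -> Z h -> T (a *: f + h) = a *: T f + T h,
        forall f, Z f -> (T f = 0 <-> B f) & forall u, exists2 f,
          Z f & T f = u].
Proof.
move=> [t [t' tK t'K]].
pose T f := if pselect (Z f) is left Zf then t (coclass Zf) else 0.
have TE f (Zf : Z f) : T f = t (coclass Zf).
  by rewrite /T; case: pselect => // Zf'; congr (t (coclass _)); exact:
    Prop_irrelevance.
have Z0 : Z 0 by case: (smodP (cocycles p G n.+1)).
exists T; split=> [a f h Zf Zh|f Zf|u].
- by rewrite (TE _ (cocyclesD a Zf Zh)) (TE _ Zf) (TE _ Zh) coclassD linearP.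
- rewrite (TE _ Zf) -[f in B f]subr0 -(coclassP Zf Z0) coclass0.
  by split=> [|->]; rewrite ?linear0// -[0 in RHS](linear0 t) => /(can_inj tK).
- have [f [Zf fE]] := coclass_surj (t' u).
  by exists f => //; rewrite TE -fE.
Qed.

(** The way back: such a [T] induces an embedding of cohomology. It need not be onto, so the
    dimension is the rank of a matrix spanning its image. *)
Lemma cohom_has_dim m (T : cfun p G n.+1 -> 'rV['F_p]_m) :
    (forall a f h, Z f -> Z h -> T (a *: f + h) = a *: T f + T h) ->
    (forall f, Z f -> (T f = 0 <-> B f)) ->
  exists M : 'M['F_p]_m, (forall u, (u <= M)%MS <-> exists2 f, Z f & T f = u) /\
    has_dim (cohom p G n.+1) (\rank M).
Proof.
move=> TD TB.
have TE f h : Z f -> Z h -> T f = T h <-> B (f - h).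
  move=> Zf Zh; rewrite -TB; last by rewrite addrC -scaleN1r; exact: cocyclesD.
  rewrite addrC -scaleN1r TD // scaleN1r addrC.
  by split=> [->|/eqP]; rewrite ?subrr // subr_eq0 => /eqP.
pose t (c : cohom p G n.+1) :=
  T (smod_val (generic_quotient.repr c : smod_type _)).
have tE f (Zf : Z f) : t (coclass Zf) = T f.
  apply/TE => //; first exact: cocycles_mem (smod_valP _).
  rewrite -[f in X in _ - X]/(smod_val (SmodType (mem_cocycles Zf))).
  have /lpiP[h hE] : lpi (coboundaries p G n.+1)
    (generic_quotient.repr (coclass Zf)) = coclass Zf by exact: lpiK.
  by exists h.
have tl : linear t.
  move=> a c c'; have [f [Zf ->]] := coclass_surj c; have [h [Zh ->]] :=
    coclass_surj c'.
  by rewrite -(coclassD Zf Zh (cocyclesD a Zf Zh)) !tE TD.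
pose tL := GRing.isLinear.Build _ _ _ _ t tl.
pose t' : {linear cohom p G n.+1 -> 'rV['F_p]_m} := HB.pack t tL.
have [|M [ME dM]] := @has_dim_image _ _ _ t'.
  move=> c c'; have [f [Zf ->]] := coclass_surj c; have [h [Zh ->]] :=
    coclass_surj c'.
  by rewrite /= !tE => ?; apply/coclassP/TE.
exists M; split=> // u; rewrite ME; split=> [[c <-]|[f Zf <-]].
  by have [f [Zf ->]] := coclass_surj c; exists f => //=; rewrite tE.
by exists (coclass Zf); rewrite /= tE.
Qed.

End CohomologyClasses.

Section SigmaClasses.
Variables (p : nat) (G : sigmaGroupType) (n : nat).
Local Notation Z := (smod (cocycles p G n.+1)).

Lemma sigma_acts_by_oppP : sigma_acts_by_opp p G n.+1 <->
  forall f : cfun p G n.+1, Z f ->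
    exists h : cfun p G n, continuous_cfun h /\ sigma_cfun f + f = coboundary h.
Proof.
have Zs f : Z f -> Z (sigma_cfun f).
  by move=> /mem_cocycles Zf; exact: cocycles_mem (sigma_cocycle (SmodType Zf)).
have E f (Zf : Z f) : sigma_cohom (coclass Zf) = coclass (Zs _ Zf).
  by rewrite /coclass sigma_cohom_pi; congr lpi; exact: val_inj.
have Z0 : Z 0 by case: (smodP (cocycles p G n.+1)).
have N f (Zf : Z f) (ZNf : Z ((-1) *: f + 0)) : - coclass Zf = coclass ZNf.
  by rewrite (coclassD Zf Z0) scaleN1r coclass0 addr0.
split=> [opp f Zf|H c].
  have := opp (coclass Zf); rewrite E (N _ _ (cocyclesD (-1) Zf Z0)) coclassP.
  by rewrite addr0 scaleN1r opprK.
have [f [Zf ->]] := coclass_surj c.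
rewrite E (N _ _ (cocyclesD (-1) Zf Z0)); apply/coclassP.
by rewrite addr0 scaleN1r opprK; exact: H.
Qed.

End SigmaClasses.

Section LowDegree.
Variables (p : nat) (G : topGroupType).

Definition chom (b : G -> 'F_p) :=
  loc_const b /\ forall x y, b (x * y)%g = b x + b y.

Definition cocycle2 (c : G -> G -> 'F_p) :=
  loc_const (fun z : G * G => c z.1 z.2) /\
  forall x y z, c y z - c (x * y)%g z + c x (y * z)%g - c x y = 0.

Definition coboundary2 (c : G -> G -> 'F_p) :=
  exists2 b : G -> 'F_p, loc_const b & forall x y,
    c x y = b x + b y - b (x * y)%g.

Definition cochain1 (b : G -> 'F_p) : cfun p G 1 := fun g => b (g ord0).
Definition cochain2 (c : G -> G -> 'F_p) : cfun p G 2 :=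
  fun g => c (g ord0) (g ord_max).

Let pair (x y : G) : 'I_2 -> G := fun i => if i == ord0 then x else y.

Lemma cochain1_surj (f : cfun p G 1) : exists b, f = cochain1 b.
Proof.
exists (fun x => f (fun=> x)); apply/funext => g; congr (f _);
  apply/funext => i.
by rewrite ord1.
Qed.

Lemma cochain2_surj (f : cfun p G 2) : exists c, f = cochain2 c.
Proof.
exists (fun x y => f (pair x y)); apply/funext => g; rewrite /cochain2.
suff -> : pair (g ord0) (g ord_max) = g by [].
apply/funext => i; rewrite /pair; case: ifPn => [/eqP -> //|i0].
by congr g; apply: val_inj; case: i i0 => [[|[|]]].
Qed.

Lemma cochain1_continuous b : continuous_cfun (cochain1 b) <-> loc_const b.
Proof.
rewrite continuous_cfunP; split=> [bc x|bc g].
  have dc : continuous (fun x : G => (fun=> x) : {ptws 'I_1 -> G}).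
    by apply: prod_continuous => i y; exact: cvg_id.
  exact: (dc x _ (bc (fun=> x))).
exact: (@proj_continuous _ (fun _ : 'I_1 => G) ord0 g _ (bc (g ord0))).
Qed.

Lemma cochain2_continuous c :
  continuous_cfun (cochain2 c) <-> loc_const (fun z : G * G => c z.1 z.2).
Proof.
rewrite continuous_cfunP; split=> [cc z|cc g].
  have dc : continuous (fun z : G * G => pair z.1 z.2 : {ptws 'I_2 -> G}).
    by apply: prod_continuous => i y; rewrite /pair; case: eqP => _;
      [exact: cvg_fst|exact: cvg_snd].
  exact: (dc z _ (cc (pair z.1 z.2))).
have pc i := @proj_continuous _ (fun _ : 'I_2 => G) i g.
have /(_ _ _ _ _ (cc (g ord0, g ord_max))) := cvg_pair (pc ord0) (pc ord_max).
apply; exact: (@nbhs_filter {ptws 'I_2 -> G} g).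
Qed.

(** Both faces of a 1-tuple are the empty tuple and carry opposite signs. Hence classes in degree
    one are the same as characters. *)
Lemma coboundary_cochain0 (f : cfun p G 0) : coboundary f = 0.
Proof.
apply/funext => g; rewrite /coboundary 2!big_ord_recl big_ord0 addr0 /=.
rewrite expr0 mul1r expr1 mulN1r; apply/eqP; rewrite subr_eq0; apply/eqP.
by congr f; apply/funext => -[].
Qed.

Lemma coboundary_cochain1 b g :
  coboundary (cochain1 b) g = b (g ord0) +
    b (g ord_max) - b (g ord0 * g ord_max)%g.
Proof.
rewrite /coboundary 3!big_ord_recl big_ord0 addr0 /= /cochain1 /face /=.
rewrite !expr0 !expr1 /bump /= !expr2 mul1r mulN1r mulrNN !mul1r.
have -> : widen_ord (leqnSn 1) ord0 = ord0 by exact: val_inj.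
have -> : lift ord0 ord0 = ord_max :> 'I_2 by exact: val_inj.
ring.
Qed.

Lemma coboundary_cochain2 c g : let i1 : 'I_3 := lift ord0 ord0 in
  coboundary (cochain2 c) g =
    c (g i1) (g ord_max) - c (g ord0 * g i1)%g (g ord_max)
    + c (g ord0) (g i1 * g ord_max)%g - c (g ord0) (g i1).
Proof.
move=> i1; rewrite /coboundary 4!big_ord_recl big_ord0 addr0 /= /cochain2 /face
  /=.
have -> : widen_ord (leqnSn 2) ord0 = ord0 by exact: val_inj.
have -> : widen_ord (leqnSn 2) ord_max = i1 by exact: val_inj.
have -> : lift ord0 ord_max = ord_max :> 'I_3 by exact: val_inj.
rewrite -/i1 /bump /= !exprS !expr0; ring.
Qed.

Lemma cocycles1P b : smod (cocycles p G 1) (cochain1 b) <-> chom b.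
Proof.
rewrite /= cochain1_continuous; split=> -[bl bM]; split=> //.
  move=> x y; move/(congr1 (@^~ (pair x y))): bM;
    rewrite coboundary_cochain1 /pair/=.
  by move=> /eqP; rewrite subr_eq0 => /eqP.
by apply/funext => g; rewrite coboundary_cochain1 bM subrr.
Qed.

Lemma cocycles2P c : smod (cocycles p G 2) (cochain2 c) <-> cocycle2 c.
Proof.
rewrite /= cochain2_continuous; split=> -[bl bM]; split=> //.
  move=> x y z; move/(congr1 (@^~ (fun i : 'I_3 => [:: x; y; z]`_i)%g)): bM.
  by rewrite coboundary_cochain2 /=.
by apply/funext => g; rewrite coboundary_cochain2 bM.
Qed.

Lemma coboundaries1P b :
  (exists h : cfun p G 0, continuous_cfun h /\ cochain1 b = coboundary h) <->
    b = 0.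
Proof.
split=> [[h [_]]|->]; last by exists 0; split;
  [exact: continuous_cfun0|rewrite coboundary_cochain0].
by rewrite coboundary_cochain0 => /(congr1 (@^~ (fun=> _))) e; apply/funext =>
  x; exact: (e x).
Qed.

Lemma coboundaries2P c :
  (exists h : cfun p G 1, continuous_cfun h /\ cochain2 c = coboundary h) <->
  coboundary2 c.
Proof.
split=> [[h [hc]]|[b bl cb]].
  have [b bE] := cochain1_surj h; move: hc; rewrite bE cochain1_continuous =>
    bl e.
  exists b => // x y; move/(congr1 (@^~ (pair x y))): e.
  by rewrite coboundary_cochain1.
exists (cochain1 b); split; first exact/cochain1_continuous.
by apply/funext => g; rewrite coboundary_cochain1 /cochain2 cb.
Qed.

Lemma cohom1_has_dim m (T : (G -> 'F_p) -> 'rV['F_p]_m) :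
    (forall a b h, chom b -> chom h -> T (fun x => a * b x + h x) = a *:
      T b + T h) ->
    (forall b, chom b -> T b = 0 -> b = 0) ->
  exists M : 'M['F_p]_m, (forall u, (u <= M)%MS <-> exists2 b,
    chom b & T b = u) /\
    has_dim (cohom p G 1) (\rank M).
Proof.
move=> TD T0; pose T' (f : cfun p G 1) := T (fun x => f (fun=> x)).
have T'E b : T' (cochain1 b) = T b by [].
have [|f Zf|M [ME dM]] := @cohom_has_dim p G 0 m T'.
- move=> a f h; have [b ->] := cochain1_surj f; have [k ->] := cochain1_surj h.
  by rewrite !cocycles1P !T'E => cb ck; rewrite -TD.
- have [b bE] := cochain1_surj f; move: Zf;
    rewrite bE cocycles1P coboundaries1P T'E => cb.
  split=> [/T0//|->]; first exact.
  have c0 : chom (0 : G -> 'F_p) by split;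
    [exact: loc_const_cst|move=> *; rewrite addr0].
  have := TD (-1) _ _ c0 c0; rewrite scaleN1r addNr => <-; congr T.
  by apply/funext => x; rewrite mulr0 addr0.
exists M; split=> // u; rewrite ME; split=> [[f Zf <-]|[b cb <-]].
  by have [b bE] := cochain1_surj f; exists b; rewrite ?bE//; apply/cocycles1P;
    rewrite -bE.
by exists (cochain1 b); rewrite ?T'E //; exact/cocycles1P.
Qed.

Lemma cohom1_coordinates m : has_dim (cohom p G 1) m ->
  exists T : (G -> 'F_p) -> 'rV['F_p]_m,
    [/\ forall a b h, chom b -> chom h -> T (fun x => a * b x + h x) = a *:
      T b + T h,
        forall b, chom b -> T b = 0 ->
          b = 0 & forall u, exists2 b, chom b & T b = u].
Proof.
move=> /cohom_coordinates[T [TD T0 TS]]; exists (T \o cochain1).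
split=> [a b h /cocycles1P cb /cocycles1P ch|b /cocycles1P cb|u].
- by rewrite -TD.
- by move=> /(T0 _ cb) /coboundaries1P.
- have [f Zf <-] := TS u; have [b bE] := cochain1_surj f; exists b;
    last by rewrite /= bE.
  by apply/cocycles1P; rewrite -bE.
Qed.

Lemma cohom2_has_dim m (T : (G -> G -> 'F_p) -> 'rV['F_p]_m) :
    (forall a c d, cocycle2 c -> cocycle2 d ->
      T (fun x y => a * c x y + d x y) = a *: T c + T d) ->
    (forall c, cocycle2 c -> (T c = 0 <-> coboundary2 c)) ->
  exists M : 'M['F_p]_m, (forall u, (u <= M)%MS <-> exists2 c,
    cocycle2 c & T c = u) /\
    has_dim (cohom p G 2) (\rank M).
Proof.
move=> TD T0; pose T' (f : cfun p G 2) := T (fun x y => f (pair x y)).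
have T'E b : T' (cochain2 b) = T b by [].
have [|f Zf|M [ME dM]] := @cohom_has_dim p G 1 m T'.
- move=> a f h; have [b ->] := cochain2_surj f; have [k ->] := cochain2_surj h.
  by rewrite !cocycles2P !T'E => cb ck; rewrite -TD.
- have [b bE] := cochain2_surj f; move: Zf;
    rewrite bE cocycles2P coboundaries2P T'E => cb.
  exact: T0.
exists M; split=> // u; rewrite ME; split=> [[f Zf <-]|[b cb <-]].
  by have [b bE] := cochain2_surj f; exists b; rewrite ?bE//; apply/cocycles2P;
    rewrite -bE.
by exists (cochain2 b); rewrite ?T'E //; exact/cocycles2P.
Qed.

Lemma cohom2_coordinates m : has_dim (cohom p G 2) m ->
  exists T : (G -> G -> 'F_p) -> 'rV['F_p]_m,
    (forall a c d, cocycle2 c -> cocycle2 d ->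
        T (fun x y => a * c x y + d x y) = a *: T c + T d) /\
    (forall c, cocycle2 c -> (T c = 0 <-> coboundary2 c)).
Proof.
move=> /cohom_coordinates[T [TD T0 TS]]; exists (T \o cochain2).
split=> [a b h /cocycles2P cb /cocycles2P ch|b /cocycles2P cb].
- by rewrite -TD.
- by rewrite -coboundaries2P; exact: T0.
Qed.

End LowDegree.

Lemma sigma_acts_by_opp1P p (G : sigmaGroupType) : sigma_acts_by_opp p G 1 <->
  forall b : G -> 'F_p, chom b -> forall x, b (sigma x) = - b x.
Proof.
rewrite sigma_acts_by_oppP; split=> [H b /cocycles1P /H|H f Zf].
  move=> /(@coboundaries1P _ _ (fun x => b (sigma x) + b x)) e x.
  by move/(congr1 (@^~ x)): e => /eqP; rewrite addr_eq0 => /eqP.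
have [b bE] := cochain1_surj f; move: Zf; rewrite bE cocycles1P => cb.
apply/(@coboundaries1P _ _ (fun x => b (sigma x) + b x)).
by apply/funext => x; rewrite H // addNr.
Qed.

Lemma sigma_acts_by_opp2P p (G : sigmaGroupType) : sigma_acts_by_opp p G 2 <->
  forall c : G -> G -> 'F_p, cocycle2 c ->
    coboundary2 (fun x y => c (sigma x) (sigma y) + c x y).
Proof.
rewrite sigma_acts_by_oppP; split=> [H b /cocycles2P /H|H f Zf].
  by move=> /(@coboundaries2P _ _ (fun x y => b (sigma x) (sigma y) + b x y)).
have [b bE] := cochain2_surj f; move: Zf; rewrite bE cocycles2P => cb.
by apply/(@coboundaries2P _ _ (fun x y => b (sigma x) (sigma y) + b x y));
  exact: H.
Qed.

(** * Profinite and pro-p groups *)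

(* The library states compact_cover for pointed spaces only. *)
Lemma compact_cover_at (T : topologicalType) (x : T) (K : set T) :
  compact K -> cover_compact K.
Proof.
pose T' : ptopologicalType :=
  HB.pack (Topological.sort T) (isPointed.Build T x).
by rewrite -[@compact T K]/(@compact T' K) compact_cover.
Qed.

(** The complements of the clopen neighbourhoods of [x] cover the compact set [K]; a finite subcover
    corresponds to a finite intersection, which is still clopen. *)
Lemma quasi_component_disjoint (T : topologicalType) (x : T) (K : set T) :
    compact [set: T] -> closed K ->
    (forall y, K y -> exists D, [/\ clopen D, D x & ~ D y]) ->
  exists D, [/\ clopen D, D x & D `&` K = set0].
Proof.
move=> cT cK KD.
have : cover_compact K by apply: (compact_cover_at x); exact:
  (subclosed_compact cK cT).
move=> /(_ _ [set D : set T | clopen D /\ D x] (fun D => ~` D)) [||D' sD' KD'].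
- by move=> D [[Do Dc] _]; exact: closed_openC.
- by move=> y /KD [D [cD Dx nDy]]; exists D.
exists (\bigcap_(D in [set` D']) D); split.
- have D'c D : [set` D'] D -> clopen D by move=> /sD' /set_mem [].
  split; last by apply: closed_bigI => D /D'c [].
  rewrite -[X in open X]setCK setC_bigcap; apply: closed_openC.
  by apply: closed_bigcup => // D /D'c [? _]; exact: open_closedC.
- by move=> D /sD' /set_mem [].
- rewrite -subset0 => y [yD /KD' [D DD']]; apply; exact: yD.
Qed.

(** In a compact Hausdorff space quasi-components are connected, so total disconnectedness reduces
    them to points. *)
Lemma totally_disconnected_zero_dimensional (T : topologicalType) :
  compact [set: T] -> hausdorff_space T -> totally_disconnected [set: T] ->
  zero_dimensional T.
Proof.
move=> cT hT tT x y xy; apply: contrapT => nU.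
pose Q := \bigcap_(D in [set D : set T | clopen D /\ D x]) D.
have Qx : Q x by move=> D [].
have Qy : Q y by move=> D [cD Dx]; apply: contrapT => nDy; apply: nU; exists D.
have Qc : closed Q by apply: closed_bigI => D [[]].
suff Qconn : connected Q.
  have : connected_component [set: T] x y by exists Q.
  by rewrite tT // => /esym/eqP; rewrite (negPf xy).
(* Normality puts disjoint open sets U and V around the two pieces, and some clopen D containing x
   lies in their union. Then D minus V equals D meet U, which is clopen and contains x, hence
   contains Q. *)
have part A B : closed A -> closed B -> A `&` B = set0 -> Q = A `|` B -> A x ->
  Q = A.
  move=> cA cB AB QAB Ax.
  have [E AE EB] : filter_from (set_nbhs A) closure (~` B).
    apply: (compact_normal hT cT cA) => z Az; apply: open_nbhs_nbhs.
    split; first exact: closed_openC.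
    by move=> Bz; have : (A `&` B) z by []; rewrite AB.
  pose U := interior E; pose V := ~` closure E.
  have oU : open U by exact: open_interior.
  have oV : open V by apply: closed_openC; exact: closed_closure.
  have AU : A `<=` U by move=> z /AE.
  have BV : B `<=` V by move=> z Bz /EB; exact.
  have UV : U `&` V = set0.
    by rewrite -subset0 => z [/interior_subset Ez]; apply; exact:
      subset_closure.
  have [|z UVz|D [[oD cD] Dx DK]] :=
    @quasi_component_disjoint _ x (~` (U `|` V)) cT.
  - by apply: open_closedC; exact: openU.
  - apply: contrapT => nD; apply: UVz.
    have : Q z by move=> D [cD Dx]; apply: contrapT => nDz; apply: nD; exists D.
    by rewrite QAB => -[/AU|/BV]; [left|right].
  have DU : clopen (D `&` U).
    split; first exact: openI.
    rewrite (_ : _ `&` _ = D `&` ~` V); first by apply: closedI => //; exact: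
      open_closedC.
    apply/seteqP; split=> z [Dz].
      by move=> Uz; split=> // Vz; have : (U `&` V) z by []; rewrite UV.
    move=> nVz; split=> //; apply: contrapT => nUz.
    by have : (D `&` ~` (U `|` V)) z; [split=> // -[]|rewrite DK].
  apply/seteqP; split=> z Qz; last by rewrite QAB; left.
  have [_ Uz] : (D `&` U) z by apply: Qz; split=> //; split=> //; exact: AU.
  move: (Qz); rewrite {1}QAB => -[//|/BV Vz].
  by have : (U `&` V) z by []; rewrite UV.
move=> A [a Aa] [C oC AE] [C' cC' AE'].
have cA : closed A by rewrite AE'; exact: closedI.
have cA' : closed (Q `&` ~` C) by apply: closedI => //; exact: open_closedC.
have AA' : A `&` (Q `&` ~` C) = set0.
  by rewrite AE -subset0 => z [[_ Cz] [_]].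
have QE : Q = A `|` (Q `&` ~` C).
  rewrite AE -setIUr (_ : C `|` ~` C = setT) ?setIT//.
  by rewrite setUv.
have : (A `|` (Q `&` ~` C)) x by rewrite -QE.
case=> [Ax|A'x]; first by rewrite (part _ _ cA cA' AA' QE Ax).
have QA' : Q = Q `&` ~` C by apply: (part _ _ cA' cA) => //;
  [rewrite setIC|rewrite setUC].
have : Q a by rewrite QE; left.
by rewrite QA' => A'a; have : (A `&` (Q `&` ~` C)) a by []; rewrite AA'.
Qed.

Section OpenNormalSubgroups.
Local Open Scope group_scope.
Variable G : topGroupType.

Lemma mulg_cont2 (T : topologicalType) (f h : T -> G) :
  continuous f -> continuous h -> continuous (fun x => f x * h x).
Proof.
move=> fc hc x; apply: (@cvg_comp _ _ _ (fun y => (f y, h y)) (fun z =>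
  z.1 * z.2)).
  exact: (cvg_pair (fc x) (hc x)).
exact: (mulg_continuous (f x, h x)).
Qed.

Lemma nbhs_mulg (x : G) (A : set G) :
    nbhs x A <-> nbhs (1 : G) (fun y => A (x * y)).
Proof.
split=> [xA|A1].
  have := @mulg_cont1 G x 1 1; rewrite /continuous_at !mulg1 => /(_ _ xA).
  by apply: (@filterS _ (nbhs (1 : G)) _ (fun y => A (x * y * 1))) => y;
    rewrite mulg1.
have := @mulg_cont1 G x^-1 1 x; rewrite /continuous_at mulg1 mulVg => /(_ _ A1).
apply: (@filterS _ (nbhs x) _ (fun y => A (x * (x^-1 * y * 1)))) => y.
by rewrite mulg1 mulVKg.
Qed.

Lemma open_subgroup (H : set G) : is_subgroup H -> nbhs 1 H -> open H.
Proof.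
move=> [H1 HM HV] nH; rewrite openE => x Hx; apply/nbhs_mulg.
by apply: filterS nH => y Hy; exact: HM.
Qed.

Variables (A : Type) (f : G -> A).

(* The syntactic congruence: a normal subgroup for free, and open by
   compactness when f is locally constant. *)
Definition periods : set G := [set g | forall x y, f (x * g * y) = f (x * y)].

Lemma periods_subgroup : is_subgroup periods.
Proof.
split=> [x y|g h Pg Ph x y|g Pg x y]; first by rewrite mulg1.
  by rewrite mulgA Ph Pg.
by rewrite -Pg mulgVK.
Qed.

Lemma periods_conj x g : periods x -> periods (x ^ g).
Proof.
move=> Px y z; rewrite conjgE !mulgA -(mulgA _ g) Px.
by rewrite -!mulgA mulKg.
Qed.

Definition period_group : normal_subgroup G :=
  NormalSubgroup periods_subgroup periods_conj.

Lemma period_group_open : compact [set: G] -> loc_const f ->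
    open (nsub period_group).
Proof.
move=> cG fl; apply: open_subgroup; first exact: periods_subgroup.
(* Compactness of G x G makes the neighbourhood of 1 uniform in the two outer factors. *)
have : compact [set: G * G] by rewrite -setXTT; exact: compact_setX.
move=> /compact_near_coveringP/(_ _ (nbhs (1 : G)) (fun g z =>
  f (z.1 * g * z.2) = f (z.1 * z.2)) _).
move=> /(_ _) h.
suff : \forall g \near (1:G),
  [set: G * G] `<=` (fun z => f (z.1 * g * z.2) = f (z.1 * z.2)).
  by apply: filterS => g gP x y; exact: (gP (x, y)).
apply: h => -[x y] _.
have c1 : continuous (fun w : (G * G) * G => w.1.1 * w.2 * w.1.2).
  apply: mulg_cont2; first apply: mulg_cont2.
  - by move=> w; apply: continuous_comp; exact: cvg_fst.
  - by move=> w; exact: cvg_snd.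
  - by move=> w; apply: continuous_comp; [exact: cvg_fst|exact: cvg_snd].
have c2 : continuous (fun w : (G * G) * G => w.1.1 * w.1.2).
  apply: mulg_cont2; move=> w.
  - by apply: continuous_comp; exact: cvg_fst.
  - by apply: continuous_comp; [exact: cvg_fst|exact: cvg_snd].
have := loc_const_map2 (fun a b =>
  (a, b)) (loc_const_comp c1 fl) (loc_const_comp c2 fl) ((x, y), 1).
by apply: filterS => -[[u v] g] /= [-> ->]; rewrite mulg1.
Qed.

Lemma period_groupP g : nsub period_group g -> f g = f 1.
Proof. by move=> /(_ 1 1); rewrite !mul1g !mulg1. Qed.

End OpenNormalSubgroups.

Section FiniteQuotients.
Local Open Scope group_scope.

Lemma finite_group_type (T : groupType) : finite_set [set: T] ->
  exists (gT : finGroupType) (f : T -> gT) (g : gT -> T),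
    [/\ cancel f g, cancel g f & {morph f : x y / x * y}].
Proof.
move=> fT; pose s : seq T := fset_set [set: T].
have sP x : x \in s by rewrite in_fset_set//; exact: mem_set.
have us : uniq s by exact: fset_uniq.
have enumP : Finite.axiom s by move=> x; rewrite count_uniq_mem ?sP.
pose unpick n := ohead (drop n s).
have pickK : pcancel (index^~ s) unpick.
  move=> x; rewrite /unpick /=.
  have lt_x : (index x s < size s)%N by rewrite index_mem.
  by rewrite (drop_nth x lt_x) /= nth_index.
pose cT := Choice_isCountable.Build T pickK.
pose eT := fintype.isFinite.Build T enumP.
pose gT : finGroupType := HB.pack (Group.sort T) cT eT.
by exists gT, id, id.
Qed.

Lemma card_bijective (T U : Type) (f : T -> U) : bijective f ->
    ([set: T] #= [set: U])%card.
Proof. by move=> /PbijTT[f' _]; exact: pcard_eq f'. Qed.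

Lemma card_finType (T : finType) m : ([set: T] #= `I_m)%card <-> #|T| = m.
Proof.
have b : ([set: 'I_#|T|] #= [set: T])%card.
  by apply: (card_bijective (f := @enum_val T T)); exists enum_rank;
    [exact: enum_valK|exact: enum_rankK].
rewrite -(card_eql b) -(card_eql (card_II (n := #|T|))).
by split=> [/card_eq_II|->].
Qed.

Lemma quotient_finGroup (G : topGroupType) (N : normal_subgroup G) :
    finite_set [set: quotg N] ->
  exists (gT : finGroupType) (f : G -> gT),
    [/\ {morph f : x y / x * y}, forall y, exists x, f x = y,
        forall x y, f x = f y <-> nsub N (x^-1 * y) &
        forall m, ([set: quotg N] #= `I_m)%card <-> #|gT| = m].
Proof.
move=> /finite_group_type[gT [f [g [fK gK fM]]]].
exists gT, (f \o @pig _ N); split=> [x y|y|x y|m].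
- by rewrite /= -fM; congr f; exact/esym/pigM.
- by exists (generic_quotient.repr (g y)); rewrite /= pigK gK.
- by rewrite -pigP /=; split=> [/(can_inj fK)|->].
- rewrite -card_finType; suff e :
    ([set: quotg N] #= [set: gT])%card by rewrite (card_eql e).
  by apply: (card_bijective (f := f)); exists g.
Qed.

(** The cosets form an open cover, and a finite subcover already meets every coset. *)
Lemma open_quotient_finite (G : topGroupType) (N : normal_subgroup G) :
  compact [set: G] -> open (nsub N) -> finite_set [set: quotg N].
Proof.
move=> cG oN.
have /(compact_cover_at (1 : G))/(_ _ [set: quotg N] (fun a =>
  @pig _ N @^-1` [set a])) := cG.
case=> [a _|x _|D _ DG]; last 1 first.
- apply: (sub_finite_set _ (finite_fset D)) => a _.
  have [b bD /= e] := DG (generic_quotient.repr a) I.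
  by rewrite -[a]pigK e.
- rewrite -[a]pigK; set x := generic_quotient.repr a.
  rewrite openE => y /= yx; apply/nbhs_mulg.
  have nN : nbhs (1 : G) (nsub N) by apply: open_nbhs_nbhs; split=> //; exact:
    nsub1.
  apply: filterS nN => n Nn /=; rewrite -yx; apply/pigP.
  by rewrite invgM mulgVK; exact: nsubV.
- by exists (pig N x).
Qed.

Lemma power_in_quotient (G : topGroupType) (N : normal_subgroup G) m :
  compact [set: G] -> ([set: quotg N] #= `I_m)%card ->
    forall x, nsub N (x ^+ m).
Proof.
move=> cG Nm x.
have [|gT [f [fM _ fP fC]]] := @quotient_finGroup _ N;
  first by apply/finite_setP; exists m.
have f1 := morph_one fM.
have fX k : f (x ^+ k) = f x ^+ k by elim: k => // k IH; rewrite !expgS fM IH.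
have /fP : f 1 = f (x ^+ m).
  rewrite f1 fX; apply/esym/eqP; rewrite -order_dvdn.
  have /fC <- := Nm; rewrite -cardsT; by apply: order_dvdG;
    rewrite finset.in_setT.
by rewrite invg1 mul1g.
Qed.

(** The elementwise form can be checked for extensions and for subgroups of products without
    computing any quotient. It follows from the cardinality form by Lagrange and implies it by
    Cauchy. *)
Lemma pro_pP (p : nat) (G : topGroupType) : prime p ->
  pro_p p G <-> [/\ compact [set: G], hausdorff_space G,
    totally_disconnected [set: G] &
    forall N : normal_subgroup G, open (nsub N) ->
      forall x, exists k, nsub N (x ^+ (p ^ k))].
Proof.
move=> pP; split=> -[cG hG tG NP]; split=> // N oN.
  by have [k Nk] := NP N oN => x; exists k; exact: power_in_quotient.
have [gT [f [fM fS fP fC]]] := quotient_finGroup (open_quotient_finite cG oN).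
have f1 := morph_one fM.
have fX k x : f (x ^+ k) = f x ^+ k by elim: k => // k IH; rewrite !expgS fM IH.
suff pT : pgroup p [set: gT]%SET.
  by have [k kE] := p_natP pT; exists k; apply/fC; rewrite -cardsT.
apply/pgroupP => q qP /(Cauchy qP) [y _ oy].
have [x xE] := fS y; have [k Nk] := NP N oN x.
have : f 1 = f (x ^+ (p ^ k)) by apply/fP; rewrite invg1 mul1g.
rewrite f1 fX xE => /esym/eqP;
  rewrite -order_dvdn oy Euclid_dvdX // dvdn_prime2 // => /andP[/eqP -> _].
by rewrite inE.
Qed.

End FiniteQuotients.

Lemma clopen_loc_const (T : topologicalType) (D : set T) :
  clopen D -> loc_const (fun x => `[< D x >]).
Proof.
move=> [oD cD] x; have [Dx|nDx] := pselect (D x).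
  have : nbhs x D by exact: open_nbhs_nbhs.
  by apply: filterS => y Dy; rewrite !asboolT.
have : nbhs x (~` D) by apply: open_nbhs_nbhs; split=> //; exact: closed_openC.
by apply: filterS => y nDy; rewrite !asboolF.
Qed.

Section ProP.
Local Open Scope group_scope.
Variables (p : nat) (G : topGroupType).
Hypotheses (pP : prime p) (Gp : pro_p p G).

(** Inside [A] there is a clopen D containing 1; a period of the indicator function of D takes 1 to
    a point of D, so the periods lie in D. *)
Lemma pro_p_open_normal (A : set G) : nbhs 1 A ->
  exists2 N : normal_subgroup G, open (nsub N) & nsub N `<=` A.
Proof.
have [cG hG tG _] := Gp => A1.
have zG := totally_disconnected_zero_dimensional cG hG tG.
have [D [D1 cD] DA] := zero_dimensional_cvg (x := 1 : G) hG zG cG A1.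
exists (period_group (fun x => `[< D x >])).
  by apply: period_group_open => //; exact: clopen_loc_const.
move=> x /period_groupP; rewrite [in RHS]asboolT // => /asboolP Dx.
exact: DA.
Qed.

Lemma pro_p_quotient (N : normal_subgroup G) : open (nsub N) ->
  exists (gT : finGroupType) (f : G -> gT),
    [/\ {morph f : x y / x * y}, forall y, exists x, f x = y,
        forall x y, f x = f y <-> nsub N (x^-1 * y) &
        pgroup p [set: gT]%SET].
Proof.
have [_ _ _ GN] := Gp => /GN[k Nk].
have [|gT [f [fM fS fP fC]]] := @quotient_finGroup _ N.
  by apply/finite_setP; exists (p ^ k)%N.
exists gT, f; split=> //; rewrite /pgroup cardsT.
by have /fC -> := Nk; rewrite pnatX pnat_id.
Qed.

Lemma separate_closed (S : set G) x : closed S -> ~ S x ->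
  exists2 N : normal_subgroup G, open (nsub N) & forall n, nsub N n ->
    ~ S (x * n).
Proof.
move=> cS nSx; apply: pro_p_open_normal; apply/(nbhs_mulg x (~` S)).
by apply: open_nbhs_nbhs; split=> //; exact: closed_openC.
Qed.

Lemma image_group (gT : finGroupType) (f : G -> gT) (S : set G) :
    {morph f : x y / x * y} -> is_subgroup S ->
  exists H : {group gT}, forall y, y \in H <-> exists2 x, S x & f x = y.
Proof.
move=> fM [S1 SM SV]; have f1 := morph_one fM.
have gH : group_set [set y | `[< exists2 x, S x & f x = y >]]%SET.
  apply/group_setP; split=> [|y z]; rewrite !finset.inE.
    by apply/asboolP; exists 1.
  move=> /asboolP[u Su <-] /asboolP[v Sv <-]; apply/asboolP.
  by exists (u * v) => //; exact: SM.
by exists (Group gH) => y; rewrite finset.inE; split=> /asboolP.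
Qed.

Lemma loc_const_quotient (T : Type) (gT : finGroupType) (f : G -> gT)
    (N : normal_subgroup G) (b : gT -> T) : open (nsub N) ->
  (forall x y, f x = f y <-> nsub N (x^-1 * y)) -> loc_const (b \o f).
Proof.
move=> oN fP x; apply/nbhs_mulg.
have nN : nbhs (1 : G) (nsub N) by apply: open_nbhs_nbhs; split=> //; exact:
  nsub1.
apply: filterS nN => n Nn /=; congr b; apply/fP.
by rewrite invgM mulgVK; exact: nsubV.
Qed.

(** An open normal U with x U disjoint from [M] keeps the images of [M] and [N] distinct in the
    finite p-group G / U, where the finite case applies. *)
Lemma pro_p_additive_along (M N : normal_subgroup G) x :
    closed (nsub M) -> nsub M `<=` nsub N -> nsub N x -> ~ nsub M x ->
  exists b : G -> 'F_p, [/\ loc_const b, additive_along (nsub N) b,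
    forall m, nsub M m -> b m = 0%R & exists2 n, nsub N n & b n != 0%R].
Proof.
move=> cM MN Nx nMx; have [U oU UM] := separate_closed cM nMx.
have [gT [f [fM fS fP pT]]] := pro_p_quotient oU.
have [M' M'P] := image_group fM (nsub_group M).
have [N' N'P] := image_group fM (nsub_group N).
have f1 := morph_one fM.
have fV u := morph_inv u fM.
have normal' (K : normal_subgroup G) (K' : {group gT}) :
    (forall y, y \in K' <-> exists2 u, nsub K u & f u = y) ->
    normal K' [set: gT]%SET.
  move=> K'P; rewrite /normal finset.subsetT /=; apply/fintype.subsetP => y _.
  have [u <-] := fS y; rewrite inE; apply/fintype.subsetP =>
    _ /imsetP[z /K'P[v Kv <-] ->].
  by apply/K'P; exists (v ^ u); [exact: nsub_conj|rewrite conjgE !fM fV].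
have [|b' [b'N b'M [n' N'n' b'n']]] :=
  finite_additive_along pP pT (normal' _ _ M'P) (normal' _ _ N'P).
  apply/properP; split; first by apply/fintype.subsetP => y /M'P[m /MN Nm <-];
    apply/N'P; exists m.
  exists (f x); first by apply/N'P; exists x.
  apply/negP => /M'P[m Mm /esym /fP /UM]; apply.
  by rewrite mulVKg.
exists (b' \o f); split.
- exact: (loc_const_quotient _ oU fP).
- case: b'N => b'r b'l; split=> u n Nn /=; rewrite fM; [apply: b'r|apply: b'l];
    by apply/N'P; exists n.
- by move=> m Mm /=; apply: b'M; apply/M'P; exists m.
- by have /N'P[n Nn fn] := N'n'; exists n; rewrite //= fn.
Qed.

(** In a suitable finite quotient the image of [S] lies in a maximal subgroup, which is normal
    there. Additivity along the whole group is being a homomorphism, so the previous construction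
    yields a character. *)
Lemma pro_p_frattini (S : set G) x : is_subgroup S -> closed S -> ~ S x ->
  exists b : G -> 'F_p, [/\ chom b, forall s, S s ->
    b s = 0%R & exists n, b n != 0%R].
Proof.
move=> gS cS nSx; have [U oU UM] := separate_closed cS nSx.
have [gT [f [fM fS fP pT]]] := pro_p_quotient oU.
have [S' S'P] := image_group fM gS.
have [S'T|[L maxL sS'L]] := maximal_exists (finset.subsetT S').
  have /S'P[s Ss /esym /fP /UM] : f x \in S' by rewrite S'T finset.inE.
  by rewrite mulVKg => /(_ Ss).
have nL := p_maximal_normal pT maxL.
have [|b [[bM _] bL [n _ bn]]] :=
  finite_additive_along pP pT nL (normal_refl _).
  by case/maxgroupP: maxL.
have [u un] := fS n.
exists (b \o f); split=> [|s Ss /=|].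
- split; first exact: (loc_const_quotient _ oU fP).
  by move=> y z /=; rewrite fM bM //= finset.inE.
- by apply: bL; apply: (fintype.subsetP sS'L); apply/S'P; exists s.
- by exists u; rewrite /= un.
Qed.

End ProP.

(** * Extensions by cocycles *)

Lemma loc_const_continuous (T : topologicalType) (A : choiceType) (f : T -> A) :
  loc_const f <-> continuous (f : T -> discrete_topology A).
Proof.
split=> [fl x B|fc x].
  rewrite nbhs_principalE => /principal_filterP Bfx.
  by apply: (@filterS _ (nbhs x)) (fl x) => y /= ->.
apply: (fc x [set f x]).
by rewrite nbhs_principalE; exact/principal_filterP.
Qed.

Lemma loc_const_clopen (T : topologicalType) (A : Type) (f : T -> A) (B :
    set A) :
  loc_const f -> clopen (f @^-1` B).
Proof.
move=> fl; have oB C : open (f @^-1` C).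
  by rewrite openE => x Cx; apply: (@filterS _ (nbhs x)) (fl x) => y /= ->.
split; first exact: oB.
by rewrite -[X in closed X]setCK; apply: open_closedC; exact: (oB (~` B)).
Qed.

Lemma zero_dimensional_hausdorff (T : topologicalType) : zero_dimensional T ->
    hausdorff_space T.
Proof.
move=> zT; rewrite open_hausdorff => x y /zT[U [[oU cU] Ux nUy]].
exists (U, ~` U) => /=; first by split; exact: mem_set.
by split=> //; [exact: closed_openC|rewrite setICr].
Qed.

Lemma pro_p_zero_dimensional (p : nat) (G : topGroupType) : prime p ->
    compact [set: G] -> zero_dimensional G ->
    (forall N : normal_subgroup G, open (nsub N) ->
      forall x : G, exists k, nsub N (x ^+ (p ^ k))%g) ->
  pro_p p G.
Proof.
move=> pP cG zG NP; apply/pro_pP => //; split=> //.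
  exact: zero_dimensional_hausdorff.
exact: zero_dimension_totally_disconnected.
Qed.

Section Extension.
Variables (p : nat) (F : topGroupType) (c : F -> F -> 'F_p).

Definition normalized_cocycle := cocycle2 c /\ c 1%g 1%g = 0.

Hypothesis cP : normalized_cocycle.

Lemma cocycleE x y z : c x y + c (x * y)%g z = c y z + c x (y * z)%g.
Proof.
have [[_ /(_ x y z) e] _] := cP; apply/eqP;
  rewrite -subr_eq0 -oppr_eq0 -[X in _ == X]e.
by apply/eqP; ring.
Qed.

Lemma cocycle1x x : c 1%g x = 0.
Proof.
have := cocycleE 1%g 1%g x; rewrite !mul1g => /addIr <-.
by have [_] := cP.
Qed.

Lemma cocyclex1 x : c x 1%g = 0.
Proof.
have := cocycleE x 1%g 1%g; rewrite !mulg1 => /addIr ->.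
by have [_] := cP.
Qed.

(* The product with the multiplication twisted by c. *)
Definition ext of normalized_cocycle : Type :=
  (discrete_topology 'F_p * F)%type.
Local Notation E := (ext cP).
HB.instance Definition _ :=
  Topological.copy E (discrete_topology 'F_p * F)%type.

Definition mule (x y : E) : E :=
  ((x.1 : 'F_p) + (y.1 : 'F_p) + c x.2 y.2, (x.2 * y.2)%g).
Definition onee : E := (0 : 'F_p, 1%g).
Definition inve (x : E) : E := (- (x.1 : 'F_p) - c x.2^-1%g x.2, (x.2^-1)%g).

Lemma muleA : associative mule.
Proof.
move=> x y z; congr pair; last exact: mulgA.
rewrite /= -[c _ _]addr0; have := cocycleE x.2 y.2 z.2 => e.
have -> : c x.2 (y.2 * z.2)%g = c x.2 y.2 +
  c (x.2 * y.2)%g z.2 - c y.2 z.2 by rewrite e; ring.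
by ring.
Qed.

Lemma mul1e : left_id onee mule.
Proof. by move=> [a x]; rewrite /mule /= cocycle1x mul1g addr0 add0r. Qed.
Lemma mule1 : right_id onee mule.
Proof. by move=> [a x]; rewrite /mule /= cocyclex1 mulg1 !addr0. Qed.
Lemma mulVe : left_inverse onee inve mule.
Proof. by move=> [a x]; rewrite /mule /inve /= mulVg; congr pair; ring. Qed.
Lemma muleV : right_inverse onee inve mule.
Proof.
move=> [a x]; rewrite /mule /inve /= mulgV; congr pair.
have := cocycleE x x^-1%g x; rewrite mulgV mulVg cocycle1x cocyclex1 !addr0 =>
  ->.
by ring.
Qed.

HB.instance Definition _ := isGroup.Build E muleA mul1e mule1 mulVe muleV.

Lemma ext_continuous (T : topologicalType) (f : T -> E) :
  continuous f <-> loc_const (fun t => (f t).1 : 'F_p) /\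
    continuous (fun t => (f t).2).
Proof.
split=> [fc|[f1 f2] t].
  split=> [|t]; last by apply: (@continuous_comp _ _ _ f snd) (fc t) _; exact:
    cvg_snd.
  apply/loc_const_continuous => t.
  by apply: (@continuous_comp _ _ _ f fst) (fc t) _; exact: cvg_fst.
have -> : f = fun t => ((f t).1, (f t).2) by apply/funext => t'; case: (f t').
move/loc_const_continuous: f1 => f1.
exact: (cvg_pair (f1 t) (f2 t)).
Qed.

Lemma ext1_loc_const : loc_const (fun x : E => x.1 : 'F_p).
Proof. by have /ext_continuous[] : continuous (id : E -> E) by move=> x; exact:
  cvg_id. Qed.

Lemma ext2_continuous : continuous (fun x : E => x.2).
Proof. by have /ext_continuous[] : continuous (id : E -> E) by move=> x; exact:
  cvg_id. Qed.

Lemma mule_continuous : continuous (fun x : E * E => (x.1 * x.2)%g).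
Proof.
have c1 (S T : topologicalType) : continuous (@fst S T) by move=> z; exact:
  cvg_fst.
have c2 (S T : topologicalType) : continuous (@snd S T) by move=> z; exact:
  cvg_snd.
have e12 : continuous (fun x : E * E => x.1.2).
  by move=> x; apply: (@continuous_comp _ _ _ fst (fun y : E => y.2));
    [exact: c1|exact: ext2_continuous].
have e22 : continuous (fun x : E * E => x.2.2).
  by move=> x; apply: (@continuous_comp _ _ _ snd (fun y : E => y.2));
    [exact: c2|exact: ext2_continuous].
apply/ext_continuous; split=> /=; last exact: mulg_cont2.
apply: loc_const_map2; first apply: loc_const_map2.
- exact: (loc_const_comp (c1 E E) ext1_loc_const).
- exact: (loc_const_comp (c2 E E) ext1_loc_const).
- have [[cl _] _] := cP.
  apply: (@loc_const_comp _ _ _ (fun z : F * F => c z.1 z.2) (fun x :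
    E * E => (x.1.2, x.2.2)) _ cl).
  by move=> x; exact: (cvg_pair (e12 x) (e22 x)).
Qed.

Lemma inve_continuous : continuous (fun x : E => (x^-1)%g).
Proof.
have ve2 : continuous (fun x : E => (x.2^-1)%g).
  by move=> x; apply: continuous_comp;
    [exact: ext2_continuous|exact: invg_continuous].
apply/ext_continuous; split=> //=.
apply: (@loc_const_map2 _ _ _ _ (fun a b : 'F_p => - a - b)); first exact:
  ext1_loc_const.
have [[cl _] _] := cP.
apply: (@loc_const_comp _ _ _ (fun z : F * F => c z.1 z.2) (fun x :
  E => (x.2^-1, x.2)%g) _ cl).
by move=> x; have e2 := @ext2_continuous x; exact: (cvg_pair (ve2 x) e2).
Qed.

HB.instance Definition _ :=
  Group_isTopGroup.Build E mule_continuous inve_continuous.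

Hypothesis pP : prime p.

Lemma ext_compact : compact [set: F] -> compact [set: E].
Proof.
move=> cF; rewrite -[X in compact X]/([set: discrete_topology 'F_p * F])
  -setXTT.
apply: compact_setX => //; apply: finite_compact.
exact: (@finite_finset 'F_p).
Qed.

Lemma ext_zero_dimensional : zero_dimensional F -> zero_dimensional E.
Proof.
move=> zF [a x] [b y]; have [<-|ab] := eqVneq (a : 'F_p) b.
  rewrite xpair_eqE eqxx /= => /zF[U [[oU cU] Ux nUy]].
  exists ((fun z : E => z.2) @^-1` U); split=> //.
  split; last by apply: preimage_closed => // z _; exact: ext2_continuous.
  by apply: open_comp => // z _; exact: ext2_continuous.
move=> _; exists ((fun z : E => z.1 : 'F_p) @^-1` [set a]); split=> //=.
  exact: loc_const_clopen ext1_loc_const.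
by move=> /= e; move: ab; rewrite e eqxx.
Qed.

(** Modulo N, the p^k-th power of an element falls into the central kernel F_p for some k, and one
    further p-th power kills that. *)
Lemma ext_pro_p : pro_p p F -> pro_p p E.
Proof.
move=> Fp; have [cF hF tF Fpow] := (pro_pP F pP).1 Fp.
apply: pro_p_zero_dimensional => //; first exact: ext_compact.
  by apply: ext_zero_dimensional; exact: totally_disconnected_zero_dimensional.
move=> N oN [a y].
(* The projection of N to F, open because projections are open maps. *)
pose N0 := [set x : F | exists a : 'F_p, nsub N ((a, x) : E)].
have mE (u v : E) : (u * v)%g = ((u.1 : 'F_p) + (v.1 : 'F_p) + c u.2 v.2,
  (u.2 * v.2)%g) :> E by [].
have gN0 : is_subgroup N0.
  split=> [|x z [b Nb] [d Nd]|x [b Nb]].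
  - by exists 0; exact: nsub1.
  - by exists (b + d + c x z); exact: (nsubM Nb Nd).
  - by exists (- b - c x^-1%g x); exact: (nsubV Nb).
have jN0 x g : N0 x -> N0 (x ^ g)%g.
  move=> [b Nb]; have := nsub_conj ((0 : 'F_p, g) : E) Nb.
  by rewrite conjgE !mE /=; eexists; eassumption.
pose N1 := NormalSubgroup gN0 jN0.
have oN1 : open (nsub N1).
  have := @snd_open (discrete_topology 'F_p) F _ oN.
  congr open; apply/seteqP; split=> [x [[b x'] Nb /= <-]|x [b Nb]];
    first by exists b.
  by exists (b, x).
have [k [b Nb]] := Fpow N1 oN1 y.
exists k.+1; set u : E := (a, y).
(* The discrepancy between the power of [u] and the element (b, y^(p^k)) of N; it is central of
   exponent p. *)
pose z : E := ((u ^+ (p ^ k))%g.1 - b : 'F_p, 1%g).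
have u2 m : (u ^+ m)%g.2 = (y ^+ m)%g by elim: m => // m IH; rewrite !expgS -IH.
pose w : E := (b, (y ^+ (p ^ k))%g).
have uE : (u ^+ (p ^ k))%g = (w * z)%g.
  rewrite mE /= cocyclex1 ?mulg1 // addr0 addrC subrK -u2.
  by case: (u ^+ _)%g.
have zc v : commute v z.
  rewrite /commute !mE /= mulg1 mul1g cocyclex1 // cocycle1x //.
  by congr pair; rewrite !addr0 addrC.
have zX m : (z ^+ m)%g = ((z.1 : 'F_p) *+ m, 1%g) :> E.
  elim: m => // m IH; rewrite expgS IH mE /= cocyclex1 // addr0 mulg1.
  by congr pair; rewrite mulrS.
rewrite expnSr expgM uE expgMn; last exact: zc.
have -> : (z ^+ p)%g = 1%g.
  by rewrite zX -mulr_natr pchar_Fp_0 // mulr0.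
have Nw m : nsub N (w ^+ m)%g.
  by elim: m => [|m IH]; [rewrite expg0; exact: nsub1|rewrite expgS; exact:
    nsubM].
by rewrite mulg1.
Qed.

End Extension.

Section FreeCochains.
Variables (p n : nat) (F : topGroupType) (x : 'I_n -> F).
Hypotheses (pP : prime p) (Fx : free_pro_p p x).

(** Freeness splits the pro-p extension defined by [c]: the map sending each generator to a lift of
    itself is a section by uniqueness, and its first component is, up to sign, a cochain with
    coboundary [c]. The sign of v in the lifts compensates for this. *)
Lemma free_cocycle_lift (c : F -> F -> 'F_p) (v : 'I_n -> 'F_p) :
  normalized_cocycle c -> exists b : F -> 'F_p,
    [/\ loc_const b, forall g h, c g h = b g + b h - b (g * h)%g &
        forall i, b (x i) = v i].
Proof.
move=> cP; have [Fp Funiv] := Fx.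
have mE (u w : ext cP) : (u * w)%g =
  ((u.1 : 'F_p) + (w.1 : 'F_p) + c u.2 w.2, (u.2 * w.2)%g) :> ext cP by [].
have [f [[fc fM fx] _]] :=
  Funiv (ext cP) (fun i => (- v i, x i)) (ext_pro_p cP pP Fp).
have [f1 f2] := (ext_continuous f).1 fc.
have fE : (fun g => (f g).2) = id.
  have [j [_ jU]] := Funiv F x Fp.
  rewrite -(jU (fun g => (f g).2)) ?(jU id) //.
  - by split=> // g; exact: cvg_id.
  - by split=> // [g h|i]; rewrite ?fM ?fx.
exists (fun g => - ((f g).1 : 'F_p)); split=> [|g h|i].
- exact: (loc_const_map2 (fun a _ : 'F_p => - a) f1 f1).
- rewrite fM mE /= -[in LHS](congr1 (@^~ g) fE) -[in LHS](congr1 (@^~ h) fE) /=.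
  by ring.
- by rewrite fx opprK.
Qed.

(** A character becomes the graph homomorphism g |-> (b g, g) into the split extension, a pro-p
    target to which the uniqueness clause applies. *)
Lemma free_chom_eq (b b' : F -> 'F_p) : chom b -> chom b' ->
  (forall i, b (x i) = b' (x i)) -> b = b'.
Proof.
move=> [bl bM] [b'l b'M] bb'; have [Fp Funiv] := Fx.
have c0 : normalized_cocycle (fun _ _ : F => 0 : 'F_p).
  by split=> //; split=> [|*]; [exact: loc_const_cst|ring].
have mE (u v : ext c0) : (u * v)%g =
  ((u.1 : 'F_p) + (v.1 : 'F_p) + 0, (u.2 * v.2)%g) :> ext c0 by [].
have [f [_ fU]] := Funiv (ext c0) (fun i =>
  (b (x i), x i)) (ext_pro_p c0 pP Fp).
have e : (fun g => (b g, g) : ext c0) = (fun g => (b' g, g)).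
  rewrite -(fU (fun g => (b g, g))) ?(fU (fun g => (b' g, g))) //.
  - split=> [|g h|i]; last by rewrite bb'.
      by apply/ext_continuous; split=> //= g; exact: cvg_id.
    by rewrite mE /= b'M addr0.
  - split=> [|g h|i] //.
      by apply/ext_continuous; split=> //= g; exact: cvg_id.
    by rewrite mE /= bM addr0.
by apply/funext => g; have := congr1 (fun f => (f g).1) e.
Qed.

Lemma free_chom (v : 'I_n -> 'F_p) : exists2 b : F ->
    'F_p, chom b & forall i, b (x i) = v i.
Proof.
have [|b [bl bM bv]] := @free_cocycle_lift (fun _ _ => 0) v.
  by split=> //; split=> [|*]; [exact: loc_const_cst|ring].
by exists b => //; split=> // g h; apply/esym/eqP; rewrite -subr_eq0 -bM.
Qed.

End FreeCochains.

(** * Free pro-p groups *)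

Section DiscreteGroup.
Variable gT : finGroupType.

Definition dgrp : Type := discrete_topology gT.
HB.instance Definition _ := Topological.copy dgrp (discrete_topology gT).
HB.instance Definition _ :=
  isGroup.Build dgrp (@mulgA gT) (@mul1g gT) (@mulg1 gT) (@mulVg gT)
    (@mulgV gT).

Lemma dgrp_loc_const (T : Type) (f : dgrp -> T) : loc_const f.
Proof.
move=> x; suff : principal_filter x [set y : discrete_topology gT | f y = f x].
  by rewrite -nbhs_principalE.
exact/principal_filterP.
Qed.

Lemma dgrp_mulg_continuous : continuous (fun x : dgrp * dgrp => (x.1 * x.2)%g).
Proof.
apply/(@loc_const_continuous _ gT).
by apply: loc_const_map2; apply: loc_const_comp (dgrp_loc_const id) => x;
  [exact: cvg_fst|exact: cvg_snd].
Qed.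

Lemma dgrp_invg_continuous : continuous (fun x : dgrp => (x^-1)%g).
Proof. exact/(@loc_const_continuous _ gT)/dgrp_loc_const. Qed.

HB.instance Definition _ :=
  Group_isTopGroup.Build dgrp dgrp_mulg_continuous dgrp_invg_continuous.
End DiscreteGroup.

Section ProductGroup.
Variables (I : choiceType) (K : I -> topGroupType).
Definition prodg : Type := prod_topology K.
HB.instance Definition _ := Topological.copy prodg (prod_topology K).

Definition prodg_mul (f g : prodg) : prodg := fun i => (f i * g i)%g.
Definition prodg_one : prodg := fun i => 1%g.
Definition prodg_inv (f : prodg) : prodg := fun i => ((f i)^-1)%g.

Lemma prodg_mulA : associative prodg_mul.
Proof. by move=> f g h; apply: functional_extensionality_dep => i; exact:
  mulgA. Qed.
Lemma prodg_mul1 : left_id prodg_one prodg_mul.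
Proof. by move=> f; apply: functional_extensionality_dep => i; exact: mul1g.
  Qed.
Lemma prodg_1mul : right_id prodg_one prodg_mul.
Proof. by move=> f; apply: functional_extensionality_dep => i; exact: mulg1.
  Qed.
Lemma prodg_mulV : left_inverse prodg_one prodg_inv prodg_mul.
Proof. by move=> f; apply: functional_extensionality_dep => i; exact: mulVg.
  Qed.
Lemma prodg_Vmul : right_inverse prodg_one prodg_inv prodg_mul.
Proof. by move=> f; apply: functional_extensionality_dep => i; exact: mulgV.
  Qed.

HB.instance Definition _ :=
  isGroup.Build prodg prodg_mulA prodg_mul1 prodg_1mul prodg_mulV prodg_Vmul.

Lemma prodg_proj i : continuous (fun f : prodg => f i).
Proof. exact: (@proj_continuous I K i). Qed.

Lemma prodg_mulg_continuous :
    continuous (fun x : prodg * prodg => (x.1 * x.2)%g).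
Proof.
apply: (@prod_continuous I K) => i; apply: mulg_cont2 => x.
  by apply: (@continuous_comp _ _ _ fst (fun f : prodg => f i));
    [exact: cvg_fst|exact: prodg_proj].
by apply: (@continuous_comp _ _ _ snd (fun f : prodg => f i));
  [exact: cvg_snd|exact: prodg_proj].
Qed.

Lemma prodg_invg_continuous : continuous (fun x : prodg => (x^-1)%g).
Proof.
apply: (@prod_continuous I K) => i x.
by apply: (@continuous_comp _ _ _ (fun f : prodg => f i) (fun y => y^-1)%g);
  [exact: prodg_proj|exact: invg_continuous].
Qed.

HB.instance Definition _ :=
  Group_isTopGroup.Build prodg prodg_mulg_continuous prodg_invg_continuous.
End ProductGroup.

Section ClosedSubgroup.
Variables (G : topGroupType) (S : set G).

Definition sgrp of is_subgroup S : Type := set_type S.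

Hypothesis gS : is_subgroup S.
Local Notation H := (sgrp gS).

HB.instance Definition _ := Topological.copy H (set_type S).
Definition sg_val (x : H) : G := set_val x.

Lemma sg_valP x : S (sg_val x). Proof. exact: set_valP. Qed.
Lemma sg_val_inj : injective sg_val. Proof. exact: val_inj. Qed.

Definition sgin (x : G) (Sx : S x) : H := SigSub (mem_set Sx).
Definition sg_mul (x y : H) : H :=
  sgin (let: And3 _ M _ := gS in M _ _ (sg_valP x) (sg_valP y)).
Definition sg_one : H := sgin (let: And3 e _ _ := gS in e).
Definition sg_inv (x : H) : H :=
  sgin (let: And3 _ _ V := gS in V _ (sg_valP x)).

Lemma sg_mulA : associative sg_mul.
Proof. by move=> x y z; apply: sg_val_inj; exact: mulgA. Qed.
Lemma sg_mul1 : left_id sg_one sg_mul.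
Proof. by move=> x; apply: sg_val_inj; exact: mul1g. Qed.
Lemma sg_1mul : right_id sg_one sg_mul.
Proof. by move=> x; apply: sg_val_inj; exact: mulg1. Qed.
Lemma sg_mulV : left_inverse sg_one sg_inv sg_mul.
Proof. by move=> x; apply: sg_val_inj; exact: mulVg. Qed.
Lemma sg_Vmul : right_inverse sg_one sg_inv sg_mul.
Proof. by move=> x; apply: sg_val_inj; exact: mulgV. Qed.

HB.instance Definition _ :=
  isGroup.Build H sg_mulA sg_mul1 sg_1mul sg_mulV sg_Vmul.

Lemma sg_val_continuous : continuous sg_val.
Proof. exact: initial_continuous. Qed.

Lemma sgrp_nbhs (x : H) A :
    nbhs x A <-> exists2 B, nbhs (sg_val x) B & sg_val @^-1` B `<=` A.
Proof.
split=> [|[B Bx BA]]; last by apply: filterS BA _; exact: sg_val_continuous.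
rewrite nbhsE => -[_ [[B oB <-] /= Bx] BA]; exists B => //.
exact: open_nbhs_nbhs.
Qed.

Lemma sgrp_continuous (T : topologicalType) (f : T -> H) :
  continuous (sg_val \o f) -> continuous f.
Proof.
move=> fc t A /sgrp_nbhs[B Bx BA].
by apply: (@filterS _ (nbhs t)) (fc t _ Bx) => y; exact: BA.
Qed.

Lemma sgrp_mulg_continuous : continuous (fun x : H * H => (x.1 * x.2)%g).
Proof.
apply: sgrp_continuous; rewrite (_ : _ \o _ = fun x :
  H * H => (sg_val x.1 * sg_val x.2)%g) //.
apply: mulg_cont2 => x.
  by apply: (@continuous_comp _ _ _ fst sg_val);
    [exact: cvg_fst|exact: sg_val_continuous].
by apply: (@continuous_comp _ _ _ snd sg_val);
  [exact: cvg_snd|exact: sg_val_continuous].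
Qed.

Lemma sgrp_invg_continuous : continuous (fun x : H => (x^-1)%g).
Proof.
apply: sgrp_continuous; rewrite (_ : _ \o _ = fun x :
  H => ((sg_val x)^-1)%g) //; move=> x.
by apply: (@continuous_comp _ _ _ sg_val (fun y => y^-1)%g);
  [exact: sg_val_continuous|exact: invg_continuous].
Qed.

HB.instance Definition _ :=
  Group_isTopGroup.Build H sgrp_mulg_continuous sgrp_invg_continuous.

Lemma sgrp_compact : compact S -> compact [set: H].
Proof.
move=> cS U UF _; have [|x [Sx Ux]] := cS (sg_val @ U) _.
  by apply: (@filterS _ U _ setT) filterT => y _; exact: sg_valP.
exists (sgin Sx); split=> // A B UA /sgrp_nbhs[C Cx CB].
have [|_ [[y Ay <-] Cy]] := Ux (sg_val @` A) C _ Cx.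
  by apply: (@filterS _ U _ A) UA => y Ay; exists y.
by exists y; split=> //; exact: CB.
Qed.

Lemma sgrp_zero_dimensional : zero_dimensional G -> zero_dimensional H.
Proof.
move=> zG x y xy; have [|U [[oU cU] Ux Uy]] := zG (sg_val x) (sg_val y).
  by apply: contra_neq xy; exact: sg_val_inj.
exists (sg_val @^-1` U); split=> //; split.
  by apply: open_comp => // z _; exact: sg_val_continuous.
by apply: preimage_closed => // z _; exact: sg_val_continuous.
Qed.

End ClosedSubgroup.

Lemma cayley_embedding (gT : finGroupType) :
  exists r : gT -> 'S_#|gT|, {morph r : x y / x * y}%g /\ injective r.
Proof.
pose r0 (a : gT) (i : 'I_#|gT|) := enum_rank (enum_val i * a)%g.
have r0I a : injective (r0 a).
  by move=> i j /enum_rank_inj/mulIg/enum_val_inj.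
exists (fun a => perm (r0I a)); split=> [a b|a b].
  by apply/permP => i; rewrite permM !permE /r0 enum_rankK mulgA.
move=> /permP/(_ (enum_rank 1%g)); rewrite !permE => /enum_rank_inj.
by rewrite enum_rankK !mul1g.
Qed.

Lemma closed_equalizer_subgroup (G H : topGroupType) (f g : G -> H) :
    hausdorff_space H -> continuous f -> continuous g ->
    {morph f : x y / x * y}%g -> {morph g : x y / x * y}%g ->
  is_subgroup [set x | f x = g x] /\ closed [set x | f x = g x].
Proof.
move=> hH fc gc fM gM.
split; first split=> /= [|x y fx fy|x fx]; first by rewrite !morph_one.
- by rewrite fM gM fx fy.
- by rewrite !morph_inv // fx.
rewrite (_ : [set x | _] = (fun x => f x * (g x)^-1)%g @^-1` [set 1%g]).
  apply: preimage_closed; last exact: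
    accessible_closed_set1 (hausdorff_accessible hH) _.
  move=> x _; apply: (mulg_cont2 fc) => z.
  by apply: (@continuous_comp _ _ _ g (fun y => y^-1)%g);
    [exact: gc|exact: invg_continuous].
apply/seteqP; split=> x /=; first by move->; rewrite mulgV.
by move=> /(congr1 (fun y => y * g x)%g); rewrite mulgVK mul1g.
Qed.

Lemma topgen_closed (G : topGroupType) (A : set G) : closed (topgen A).
Proof. by apply: closed_bigI => H [_ ? _]. Qed.

Lemma topgen_min (G : topGroupType) (A H : set G) : is_subgroup H -> closed H ->
  A `<=` H -> topgen A `<=` H.
Proof. by move=> gH cH AH x; apply. Qed.

Lemma topgen_sub (G : topGroupType) (A : set G) : A `<=` topgen A.
Proof. by move=> x Ax H [_ _]; apply. Qed.

Section FreeProP.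
Variables (p n : nat).
Hypothesis pP : prime p.

Definition genset (j : {k : nat & {ffun 'I_n -> 'S_k}}) : {set 'S_(tag j)} :=
  finset (fun s => s \in codom (tagged j)).

(* By Cayley's theorem every n-generated finite p-group occurs among these. *)
Definition free_index : Type :=
  {j : {k : nat & {ffun 'I_n -> 'S_k}} | pgroup p <<genset j>>%g}.
HB.instance Definition _ := Choice.on free_index.

Definition free_coord (j : free_index) : topGroupType := dgrp 'S_(tag (val j)).

Local Notation P := (prodg free_coord).

Definition free_gen (i : 'I_n) : P := fun j => tagged (val j) i.

Definition free_group : Type := sgrp (topgen_subgroup (range free_gen)).
HB.instance Definition _ := TopGroup.on free_group.

Definition free_var (i : 'I_n) : free_group :=
  sgin (topgen_subgroup (range free_gen)) (topgen_sub (imageT free_gen i)).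

Definition free_val (g : free_group) : P :=
  sg_val (gS := topgen_subgroup (range free_gen)) g.

Lemma free_valP g : topgen (range free_gen) (free_val g). Proof. exact:
    sg_valP. Qed.

Lemma free_nbhs (g : free_group) A :
  nbhs g A <-> exists2 B, nbhs (free_val g) B & free_val @^-1` B `<=` A.
Proof. exact: (@sgrp_nbhs _ _ (topgen_subgroup (range free_gen))). Qed.

(** Density of the generated subgroup. A set closed in [free_group] has closed image in the product
    because the subgroup itself is closed there. *)
Lemma free_group_ind (D : set free_group) : is_subgroup D -> closed D ->
  (forall i, D (free_var i)) -> forall g, D g.
Proof.
move=> [D1 DM DV] cD Dx g.
pose D' := free_val @` D.
suff [h Dh /sg_val_inj <-] : D' (free_val g) by [].
have := free_valP g; apply: topgen_min.
- split=> [|_ _ [x Dx' <-] [y Dy <-]|_ [x Dx' <-]].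
  + by exists 1%g.
  + by exists (x * y)%g => //; exact: DM.
  + by exists (x^-1)%g => //; exact: DV.
- rewrite closedE => z; apply: contra_notP => nDz.
  have [Sz|nSz] := pselect (topgen (range free_gen) z); last first.
    apply: (@filterS _ (nbhs z) _ (~` topgen (range free_gen))).
      by move=> y nSy [h _ hy]; apply: nSy; rewrite -hy; exact: free_valP.
    by apply: open_nbhs_nbhs; split=> //; apply: closed_openC; exact:
      topgen_closed.
  pose z' : free_group := sgin (topgen_subgroup (range free_gen)) Sz.
  have nDz' : nbhs z' (~` D).
    apply: open_nbhs_nbhs; split; first exact: closed_openC.
    by move=> Dz'; apply: nDz; exists z'.
  have [B Bz BD] := (free_nbhs _ _).1 nDz'.
  apply: (@filterS _ (nbhs z)) Bz => y By [h Dh hy].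
  by apply: (BD h) Dh; rewrite /= hy.
- by move=> _ [i _ <-]; exists (free_var i).
Qed.

(** Compactness is Tychonoff's theorem. For the power condition, every coordinate of an element lies
    in a finite p-group, so its p^k-th powers converge to 1 and eventually enter any open
    subgroup. *)
Lemma free_group_pro_p : pro_p p free_group.
Proof.
have cP : compact [set: P].
  rewrite (_ : [set: P] = [set f :
    forall j, free_coord j | forall j, setT (f j)]).
    apply: (@tychonoff free_index free_coord (fun=> setT)) => j.
    by apply: finite_compact; exact: (@finite_finset 'S_(tag (val j))).
  by apply/seteqP; split.
apply: pro_p_zero_dimensional => //.
- apply: sgrp_compact; apply: (subclosed_compact _ cP) => //; exact:
    topgen_closed.
- apply: sgrp_zero_dimensional; apply:
    (@zero_dimension_prod free_index free_coord) => j s t st.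
  exists [set s]; split=> //; last by move=> /= ts; rewrite ts eqxx in st.
  exact: (loc_const_clopen (f := id) [set s] (@dgrp_loc_const _ _ id)).
- move=> N oN g.
  (* The condition on one coordinate cuts out a clopen subgroup of the product containing the
     generators. *)
  have coord j : free_val g j \in <<genset (val j)>>%g.
    have := free_valP g; apply:
      (@topgen_min P (range free_gen) (fun f => f j \in <<genset (val j)>>%g)).
    + split=> [|x y|x]; [exact: group1|exact: groupM|by rewrite groupV].
    + have [] := @loc_const_clopen P _ (fun f =>
        f j) [set s | s \in <<genset (val j)>>%g] => // f.
      exact: (@prodg_proj _ free_coord j f _ (@dgrp_loc_const _ _ id (f j))).
    + move=> _ [i _ <-]; apply: mem_gen; rewrite finset.inE; exact: codom_f.
  have gX k j : free_val (g ^+ k)%g j = (free_val g j ^+ k)%g.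
    by elim: k => // k IH; rewrite !expgS -IH.
  have : (free_val (g ^+ (p ^ k))%g : P) @[k --> \oo] --> (1%g : P).
    apply: (@prod_cvg free_index free_coord) => j A A1.
    have [m oj] := p_natP (mem_p_elt (valP j) (coord j)).
    exists m => // k /= mk.
    have e : (free_val g j ^+ (p ^ k) = 1)%g.
      by apply/eqP; rewrite -[_ == _](@order_dvdn 'S_(tag (val j))) oj
        dvdn_exp2l.
    by rewrite gX e; exact: nbhs_singleton A1.
  have nN : nbhs (1%g : free_group) (nsub N).
    by apply: open_nbhs_nbhs; split=> //; exact: nsub1.
  have [B B1 BN] := (free_nbhs _ _).1 nN.
  by move=> /(_ _ B1) [k _ Bk]; exists k; apply: BN; exact: (Bk k (leqnn k)).
Qed.

Section UniversalMap.
Variables (H : topGroupType) (h : 'I_n -> H).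
Hypothesis Hp : pro_p p H.

Definition realizes (j : free_index) (r : H -> 'S_(tag (val j))) :=
  [/\ {morph r : x y / x * y}%g, loc_const r & forall i,
    r (h i) = tagged (val j) i].

(** The index is Cayley's embedding of H / U together with the images of the [h i]. Those images
    generate a subgroup of a copy of H / U, hence a p-group. *)
Lemma realizes_open (U : normal_subgroup H) : open (nsub U) ->
  exists j r, @realizes j r /\ forall x y, r x = r y -> nsub U (x^-1 * y)%g.
Proof.
move=> oU; have [gT [f [fM _ fP pT]]] := pro_p_quotient pP Hp oU.
have [r [rM rI]] := cayley_embedding gT.
pose j : {k : nat & {ffun 'I_n -> 'S_k}} :=
  Tagged (fun k => {ffun 'I_n -> 'S_k}) [ffun i => r (f (h i))].
have pj : pgroup p <<genset j>>%g.
  have rm : {in [set: gT]%SET &, {morph r : x y / x * y}%g} by move=> x y _ _;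
    exact: rM.
  apply: (pgroupS _ (morphim_pgroup (Morphism rm) pT)); rewrite gen_subG.
  apply/fintype.subsetP => s; rewrite finset.inE => /codomP[i ->];
    rewrite ffunE.
  by apply/morphimP; exists (f (h i)); rewrite ?finset.inE.
exists (exist _ j pj), (r \o f); split; last by move=> x y /= /rI/fP.
split=> [x y||i]; [by rewrite /= fM rM|exact:
  (loc_const_quotient r oU fP)|by rewrite /= ffunE].
Qed.

Lemma pro_p_separated (x y : H) :
  (forall U : normal_subgroup H, open (nsub U) -> nsub U (x^-1 * y)%g) -> x = y.
Proof.
move=> xy; have [_ hH _ _] := Hp; apply: contrapT => nxy.
have [|U oU UM] := @separate_closed p H Hp [set y] x _ nxy.
  exact: accessible_closed_set1 (hausdorff_accessible hH) _.
by apply: (UM _ (xy _ oU)); rewrite /= mulVKg.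
Qed.

(* The image of g under the map F -> H extending x_i |-> h i, tested in all
   finite quotients of H. *)
Definition realized_by (g : P) (y : H) := forall j r, @realizes j r ->
  r y = g j.

Lemma realized_by_uniq g y z : realized_by g y -> realized_by g z -> y = z.
Proof.
move=> gy gz; apply: pro_p_separated => U /realizes_open[j [r [rr]]]; apply.
by rewrite (gy _ _ rr) (gz _ _ rr).
Qed.

(** The points of the product that have an image form a subgroup containing the generators, and
    compactness of [H] makes it closed. *)
Lemma realized_ex (g : free_group) : exists y, realized_by (free_val g) y.
Proof.
have [cH _ _ _] := Hp; have := free_valP g.
have r1 j r : @realizes j r -> r 1%g = 1%g.
  by move=> [rM _ _]; exact: morph_one.
apply: (@topgen_min P (range free_gen) (fun f => exists y, realized_by f y)).
- split.
  + by exists 1%g => j r /r1.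
  + move=> f f' [y fy] [y' fy']; exists (y * y')%g => j r rr.
    by have [rM _ _] := rr; rewrite rM (fy _ _ rr) (fy' _ _ rr).
  + move=> f [y fy]; exists (y^-1)%g => j r rr.
    apply: (mulgI (r y)); have [<- _ _] := rr; rewrite mulgV (r1 _ _ rr).
    by rewrite (fy _ _ rr); exact/esym/(mulgV (f j)).
- rewrite closedE => f; apply: contra_notP => nf.
  have /compact_near_coveringP/(_ P (nbhs f) (fun f' y =>
    ~ realized_by f' y) _) := cH.
  (* If f has no image, each candidate y fails at some coordinate. The same failure persists for
     nearby y and nearby f, so compactness of [H] gives a neighbourhood of f without images. *)
  have hcov : forall y : H, [set: H] y ->
    \forall y' \near y & f' \near f, ~ realized_by f' y'.
    move=> y _; have /existsNP[j /existsNP[r /not_implyP[rr ry]]] :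
      ~ realized_by f y.
      by move=> fy; apply: nf; exists y.
    have [_ rl _] := rr.
    have fl := @prodg_proj _ free_coord j f _ (@dgrp_loc_const _ _ id (f j)).
    exists ([set y' | r y' = r y], [set f' : P | f' j = f j]).
      by split; [exact: rl|exact: fl].
    by move=> [y' f'] /= [e e'] /(_ _ _ rr); rewrite e e'.
  move=> /(_ hcov); apply: filterS => f' Hf' [y fy].
  exact: (Hf' y I fy).
- by move=> _ [i _ <-]; exists (h i) => j r [].
Qed.

Lemma free_group_universal : exists! f : free_group -> H,
  [/\ continuous f, {morph f : a b / (a * b)%g} & forall i,
    f (free_var i) = h i].
Proof.
pose f g := sval (cid (realized_ex g)).
have fP g : realized_by (free_val g) (f g) by rewrite /f; case: cid.
have free_valM a b : free_val (a * b)%g = (free_val a * free_val b)%g by [].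
have fM : {morph f : a b / (a * b)%g}.
  move=> a b; apply: (realized_by_uniq (fP (a * b)%g)) => j r rr;
    have [rM _ _] := rr.
  by rewrite rM free_valM (fP a _ _ rr) (fP b _ _ rr).
have fx i : f (free_var i) = h i.
  by apply: (realized_by_uniq (fP (free_var i))) => j r [_ _ rx]; exact: rx.
(* Modulo an open subgroup U the value of f is read off one coordinate, which is locally
   constant. *)
have fc : continuous f.
  move=> g A /nbhs_mulg /(pro_p_open_normal Hp)[U oU UA].
  have [j [r [rr rU]]] := realizes_open oU.
  apply/free_nbhs; exists [set f' : P | f' j = free_val g j].
    exact: (@prodg_proj _ free_coord j (free_val g) _
      (@dgrp_loc_const _ _ id (free_val g j))).
  move=> g' /= e; have : r (f g) =
    r (f g') by rewrite (fP g _ _ rr) (fP g' _ _ rr).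
  by move=> /rU /UA; rewrite mulVKg.
exists f; split=> // f' [f'c f'M f'x]; apply/funext.
have [_ hH _ _] := Hp.
have [gE cE] := closed_equalizer_subgroup hH fc f'c fM f'M.
by apply: (free_group_ind gE cE) => i /=; rewrite fx f'x.
Qed.

End UniversalMap.

Lemma free_group_free : free_pro_p p free_var.
Proof. by split=> [|H h Hp];
  [exact: free_group_pro_p|exact: free_group_universal]. Qed.

End FreeProP.

Lemma free_pro_p_sigma (p n : nat) : prime p ->
  exists (F : sigmaGroupType) (x : 'I_n -> F),
    free_pro_p p x /\ forall i, sigma (x i) = ((x i)^-1)%g.
Proof.
move=> pP; pose F0 := free_group p n; pose x : 'I_n -> F0 := @free_var p n.
have Ff : free_pro_p p x := free_group_free n pP; have [Fp Fu] := Ff.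
have [s [[sc sM sx] _]] := Fu F0 (fun i => (x i)^-1)%g Fp.
have sK : involutive s.
  have [j [_ jU]] := Fu F0 x Fp.
  have e : s \o s = id.
    rewrite -(jU (s \o s)) ?(jU id) //.
    - by split=> // g; exact: cvg_id.
    - split=> [g|g g'|i]; first by apply: continuous_comp; exact: sc.
        by rewrite /= !sM.
      by rewrite /= sx morph_inv // sx invgK.
  by move=> g; have := congr1 (@^~ g) e.
pose sF := hasSigma.Build F0 sM sK sc.
pose F : sigmaGroupType := HB.pack F0 sF.
by exists F, x.
Qed.

(** * Transgression *)

Lemma chom1 (p : nat) (H : topGroupType) (b : H -> 'F_p) : chom b -> b 1%g = 0.
Proof.
by move=> [_ /(_ 1%g 1%g)]; rewrite mulg1 => /esym/(canRL (addrK _));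
  rewrite subrr.
Qed.

Lemma chomV (p : nat) (H : topGroupType) (b : H -> 'F_p) x : chom b ->
    b x^-1%g = - b x.
Proof.
move=> bP; apply/eqP; rewrite -addr_eq0; have [_ bM] := bP.
by rewrite -bM mulVg (chom1 bP).
Qed.

Lemma cocycle2_linear (p : nat) (G : topGroupType) (a : 'F_p) (c d : G -> G ->
    'F_p) :
  cocycle2 c -> cocycle2 d -> cocycle2 (fun u v => a * c u v + d u v).
Proof.
move=> [cl cP] [dl dP]; split; first exact:
  (loc_const_map2 (fun s t => a * s + t) cl dl).
move=> u v w; transitivity
  (a * (c v w - c (u * v)%g w + c u (v * w)%g - c u v) +
  (d v w - d (u * v)%g w + d u (v * w)%g - d u v)); first by ring.
by rewrite cP dP mulr0 addr0.
Qed.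

Section OpenEpimorphism.
Variables (p : nat) (F G : topGroupType) (pi : F -> G).

(** Presents G as a topological quotient of F without naming a quotient type; openness is what lets
    locally constant functions descend. *)
Definition open_epi :=
  [/\ {morph pi : x y / (x * y)%g}, continuous pi, forall y, exists x,
    pi x = y &
      forall x A, nbhs x A -> nbhs (pi x) (pi @` A)].

Hypothesis piP : open_epi.

Definition hom_kernel : set F := [set x | pi x = 1%g].

Lemma open_epi1 : pi 1%g = 1%g.
Proof. by have [piM _ _ _] := piP; exact: morph_one. Qed.

Lemma open_epiV x : pi x^-1%g = (pi x)^-1%g.
Proof. by have [piM _ _ _] := piP; exact: morph_inv. Qed.

Lemma hom_kernelP x y : pi x = pi y <-> hom_kernel (x^-1 * y)%g.
Proof.
have [piM _ _ _] := piP; rewrite /hom_kernel /= piM open_epiV.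
by split=> [->|/(canRL (mulKg _))]; rewrite ?mulVg ?invgK ?mulg1.
Qed.

Lemma loc_const_descend (A : Type) (f : G -> A) : loc_const (f \o pi) ->
    loc_const f.
Proof.
have [_ _ piS piO] := piP => fl y; have [x <-] := piS y.
by apply: (@filterS _ (nbhs (pi x))) (piO _ _ (fl x)) => _ [z fz <-].
Qed.

Lemma loc_const_descend2 (A : Type) (f : G -> G -> A) :
  loc_const (fun z : F * F => f (pi z.1) (pi z.2)) ->
    loc_const (fun z : G * G => f z.1 z.2).
Proof.
have [_ _ piS piO] := piP => fl [y y']; have [x <-] := piS y; have [x' <-] :=
  piS y'.
have [[U V] /= [Ux Vx'] UV] := fl (x, x').
exists (pi @` U, pi @` V); first by split; exact: piO.
by move=> [_ _] /= [[u Uu <-] [v Vv <-]]; exact: (UV (u, v)).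
Qed.

Lemma open_epi_section : exists s : G -> F, cancel s pi.
Proof.
have [_ _ piS _] := piP; exists (fun y => sval (cid (piS y))) => y.
by case: cid.
Qed.

Implicit Types (b : F -> 'F_p) (c : G -> G -> 'F_p).

Lemma additive_along1 b : additive_along hom_kernel b -> b 1%g = 0.
Proof.
move=> [br _]; have := br 1%g 1%g open_epi1; rewrite mulg1.
by move=> /esym/(canRL (addrK _)); rewrite subrr.
Qed.

Lemma additive_alongV b n : additive_along hom_kernel b -> hom_kernel n ->
    b n^-1%g = - b n.
Proof.
move=> ba Nn; have [br _] := ba; apply/eqP; rewrite -addr_eq0 -br //.
by rewrite mulVg (additive_along1 ba).
Qed.

(* An invariant character of the kernel is represented by an extension b of it
   to F, so that the transgression H^1(N)^G -> H^2(G) becomes linear in b. *)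
Lemma transgression : exists t : (F -> 'F_p) -> G -> G -> 'F_p, forall b,
  additive_along hom_kernel b ->
    forall x y, t b (pi x) (pi y) = b x + b y - b (x * y)%g.
Proof.
have [piM _ _ _] := piP; have [s sK] := open_epi_section.
exists (fun b u v => b (s u) + b (s v) - b (s u * s v)%g) => b [br bl] x y.
have sE z : exists2 n, hom_kernel n & s (pi z) = (z * n)%g.
  exists (z^-1 * s (pi z))%g; last by rewrite mulVKg.
  by apply/hom_kernelP; rewrite sK.
have [n Nn ->] := sE x; have [m Nm ->] := sE y.
have Nny : hom_kernel (n ^ y)%g.
  by rewrite /hom_kernel /= conjgE !piM open_epiV Nn mul1g mulVg.
have bny : b (n ^ y)%g = b n.
  have := bl y n Nn; rewrite -[(n * y)%g]/((n * y)%g) conjgC br // addrC =>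
    /addIr.
  exact.
have -> : (x * n * (y * m) = x * y * (n ^ y * m))%g by rewrite conjgE !mulgA
  mulgK.
have Nnym : hom_kernel (n ^ y * m)%g by rewrite /hom_kernel /= piM Nny Nm mulg1.
by rewrite (br _ _ Nn) (br _ _ Nnym) !(br _ _ Nm) bny; ring.
Qed.

Lemma cocycle2_descend b c : loc_const b ->
  (forall x y, c (pi x) (pi y) = b x + b y - b (x * y)%g) -> cocycle2 c.
Proof.
have [piM _ piS _] := piP => bl cE; split.
  apply: loc_const_descend2.
  rewrite (_ : (fun _ => _) = fun z : F * F =>
    b z.1 + b z.2 - b (z.1 * z.2)%g); last first.
    by apply/funext => z; rewrite cE.
  have fl (f : F * F -> F) : continuous f -> loc_const (fun z => b (f z)).
    by move=> fc; exact: (loc_const_comp fc bl).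
  have l1 : loc_const (fun z : F * F => b z.1) by apply: fl => z; exact:
    cvg_fst.
  have l2 : loc_const (fun z : F * F => b z.2) by apply: fl => z; exact:
    cvg_snd.
  have l12 := loc_const_map2 (fun s t : 'F_p => s + t) l1 l2.
  exact: (loc_const_map2 (fun s t :
    'F_p => s - t) l12 (fl _ (@mulg_continuous F))).
move=> u v w; have [x <-] := piS u; have [y <-] := piS v; have [z <-] := piS w.
by rewrite -!piM !cE mulgA; ring.
Qed.

(* Subtracting the coboundary c 1 1 normalizes c, and forces b 1 = 0. *)
Definition trivializes c b := loc_const b /\
  forall x y, c (pi x) (pi y) - c 1%g 1%g = b x + b y - b (x * y)%g.

Lemma cocycle2_1r c u : cocycle2 c -> c u 1%g = c 1%g 1%g.
Proof.
move=> [_ /(_ u 1%g 1%g)]; rewrite !mulg1 => e.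
by apply/eqP; rewrite -subr_eq0 -oppr_eq0 -[X in _ == X]e; apply/eqP; ring.
Qed.

Lemma cocycle2_1l c u : cocycle2 c -> c 1%g u = c 1%g 1%g.
Proof.
move=> [_ /(_ 1%g 1%g u)]; rewrite !mul1g => e.
by apply/eqP; rewrite -subr_eq0 -[X in _ == X]e; apply/eqP; ring.
Qed.

Lemma trivializes_additive c b : cocycle2 c -> trivializes c b ->
    additive_along hom_kernel b.
Proof.
move=> cP [_ cb]; split=> x n Nn.
  have := cb x n; rewrite Nn (cocycle2_1r _ cP) subrr => /esym/eqP.
  by rewrite subr_eq0 => /eqP.
have := cb n x; rewrite Nn (cocycle2_1l _ cP) subrr => /esym/eqP.
by rewrite subr_eq0 => /eqP.
Qed.

Lemma trivializes_linear a c d b e : trivializes c b -> trivializes d e ->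
  trivializes (fun u v => a * c u v + d u v) (fun x => a * b x + e x).
Proof.
move=> [bl cb] [el de]; split.
  exact: (loc_const_map2 (fun s t : 'F_p => a * s + t) bl el).
move=> x y; transitivity (a * (c (pi x) (pi y) - c 1%g 1%g) +
  (d (pi x) (pi y) - d 1%g 1%g)).
  by ring.
by rewrite cb de; ring.
Qed.

Lemma trivializes_uniq c b b' : trivializes c b -> trivializes c b' ->
    chom (fun x => b x - b' x).
Proof.
move=> [bl cb] [b'l cb']; split; first exact:
  (loc_const_map2 (fun s t : 'F_p => s - t) bl b'l).
move=> x y; have e : b x + b y - b (x * y)%g = b' x +
  b' y - b' (x * y)%g by rewrite -cb -cb'.
apply/eqP; rewrite -subr_eq0; apply/eqP.
by move/eqP: e; rewrite eq_sym -subr_eq0 => /eqP e; rewrite -[RHS]e; ring.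
Qed.

Lemma trivializes_chom c b h : trivializes c b -> chom h ->
    trivializes c (fun x => b x - h x).
Proof.
move=> [bl cb] [hl hM]; split; first exact:
  (loc_const_map2 (fun s t : 'F_p => s - t) bl hl).
by move=> x y; rewrite cb hM; ring.
Qed.

Lemma trivializes_kernel0 c b : cocycle2 c -> trivializes c b ->
  (forall n, hom_kernel n -> b n = 0) -> coboundary2 c.
Proof.
move=> cP cb b0; have [br _] := trivializes_additive cP cb.
have [piM _ piS _] := piP; have [s sK] := open_epi_section.
(* Being trivial on the kernel, [b] descends to G; the added constant undoes the normalization of
   [c]. *)
pose f u := b (s u) + c 1%g 1%g.
have fE x : f (pi x) = b x + c 1%g 1%g.
  have Nx : hom_kernel (x^-1 * s (pi x))%g by apply/hom_kernelP; rewrite sK.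
  by rewrite /f -[s (pi x)](mulVKg x) (br _ _ Nx) (b0 _ Nx) addr0.
exists f.
  apply: loc_const_descend; rewrite (_ : _ \o _ = fun x => b x + c 1%g 1%g);
    last exact/funext.
  by have [bl _] := cb; exact:
    (loc_const_map2 (fun s _ => s + c 1%g 1%g) bl bl).
move=> u v; have [x <-] := piS u; have [y <-] := piS v.
have [_ /(_ x y) e] := cb; rewrite -piM !fE; move: e => /(canRL (subrK _)) ->;
  ring.
Qed.

Lemma trivializes_coboundary f :
  loc_const f -> trivializes (fun u v => f u + f v - f (u * v)%g) (fun x =>
    f (pi x) - f 1%g).
Proof.
have [piM pic _ _] := piP => fl; split.
  have fpl := loc_const_comp pic fl; exact:
    (loc_const_map2 (fun s _ => s - f 1%g) fpl fpl).
by move=> x y; rewrite piM mulg1; ring.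
Qed.

Lemma chom_inflate (b : G -> 'F_p) : chom b -> chom (b \o pi).
Proof.
have [piM pic _ _] := piP; move=> [bl bM]; split; first exact:
  (loc_const_comp pic bl).
by move=> y z; rewrite /= piM bM.
Qed.

End OpenEpimorphism.

(** * Presentations *)

Definition sigma_presentation (p n : nat) (F G : sigmaGroupType)
    (x r : 'I_n -> F) (pi : F -> G) :=
  [/\ free_pro_p p x, forall i, sigma (x i) = ((x i)^-1)%g &
      forall i, minus_part (r i)] /\
  [/\ open_epi pi, {morph pi : y / sigma y} & hom_kernel pi =
    topgen (Defs.conjugates r)].

Lemma sigma_presentedP (p n : nat) (G : sigmaGroupType) :
  sigma_presented p n G <->
  exists (F : sigmaGroupType) (x r : 'I_n -> F) (pi : F -> G),
    sigma_presentation p x r pi.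
Proof.
(* Forwards, [pi] is the quotient map followed by the inverse isomorphism. Backwards, the two maps
   exist because [pi] and the quotient map have the same fibres. *)
split=> [[F [x [Fx sx [r [rm [f [g [[fK gK fc gc] [fM fs]]]]]]]]]|].
  pose q (u : F) : relG rm := pig (relN rm) u.
  have qM u v : q (u * v)%g = (q u * q v)%g by exact/esym/pigM.
  have gM : {morph g : a b / (a * b)%g}.
    by move=> a b; apply: (can_inj fK); rewrite fM !gK.
  exists F, x, r, (g \o q); split=> //; split.
  - split=> [u v|u|y|u A uA].
    + by rewrite /= qM gM.
    + by apply: (@continuous_comp _ _ _ q g); [exact: pig_continuous|exact: gc].
    + exists (generic_quotient.repr (f y : quotg (relN rm))).
      by rewrite /= /q pigK fK.
    + have /= qA := pig_nbhs (relN rm) uA.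
      have : nbhs (g (q u)) (f @^-1` (q @` A)) by apply: fc; rewrite gK; exact:
        qA.
      apply: filterS => y [v Av qv]; exists v => //.
      by rewrite /= qv fK.
  - move=> u /=; apply: (can_inj fK); rewrite fs !gK.
    by exact/esym/(@sigmaq_pig F (relN rm)).
  - have g1 := morph_one gM.
    apply/seteqP; split=> u.
      rewrite /hom_kernel /= -g1 => /(can_inj gK) /esym /(pigP (relN rm) 1%g u).
      by rewrite invg1 mul1g.
    move=> Nu; rewrite /hom_kernel /= -g1; congr g;
      apply/esym/(pigP (relN rm) 1%g u).
    by rewrite invg1 mul1g.
move=> [F [x [r [pi [[Fx sx rm] [piP pis Npi]]]]]].
exists F, x; split=> //; exists r, rm.
have [piM pic piS piO] := piP.
pose q (u : F) : relG rm := pig (relN rm) u.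
have qM u v : q (u * v)%g = (q u * q v)%g by exact/esym/pigM.
have [s sK] := open_epi_section piP.
have qpi u v : pi u = pi v <-> q u = q v.
  by rewrite (hom_kernelP piP) Npi; split=> /(pigP (relN rm)).
pose f y := q (s y).
have fpi u : f (pi u) = q u by apply/qpi; rewrite sK.
pose g (a : relG rm) := pi (generic_quotient.repr (a : quotg (relN rm))).
have gq u : g (q u) = pi u by apply/qpi; rewrite /q pigK.
have qS (a : relG rm) : exists u, q u = a.
  by exists (generic_quotient.repr (a : quotg (relN rm))); exact: pigK.
exists f, g; split; first split.
- by move=> y; rewrite /f gq sK.
- by move=> a; have [u <-] := qS a; rewrite gq fpi.
- move=> y; have [u <-] := piS y => A; rewrite fpi => qA.
  have := piO _ _ (@pig_continuous _ (relN rm) u _ qA).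
  by apply: filterS => _ [v Av <-]; rewrite /= fpi.
- apply: (@quotg_continuous _ (relN rm)); rewrite (_ : _ \o _ = pi) //.
  by apply/funext => u; exact: gq.
- split=> [y z|y].
    by have [u <-] := piS y; have [v <-] := piS z; rewrite -piM !fpi qM.
  have [u <-] := piS y; rewrite -pis !fpi.
  by exact/esym/(@sigmaq_pig F (relN rm)).
Qed.

Section PresentationCohomology.
Variables (p n : nat) (F G : sigmaGroupType) (x r : 'I_n -> F) (pi : F -> G).
Hypotheses (pP : prime p) (pres : sigma_presentation p x r pi).

Let Fx : free_pro_p p x. Proof. by have [[]] := pres. Qed.
Let sx i : sigma (x i) = ((x i)^-1)%g. Proof. by have [[]] := pres. Qed.
Let sr i : sigma (r i) = ((r i)^-1)%g. Proof. by have [[_ _ /(_ i)]] := pres.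
  Qed.
Let piP : open_epi pi. Proof. by have [_ []] := pres. Qed.
Let pis y : pi (sigma y) = sigma (pi y). Proof. by have [_ []] := pres. Qed.
Let piK : hom_kernel pi = topgen (Defs.conjugates r). Proof. by have [_ []] :=
  pres. Qed.

Implicit Types (b h : F -> 'F_p) (c : G -> G -> 'F_p).

Let Nr i : hom_kernel pi (r i).
Proof. by rewrite piK; apply: topgen_sub; exists i, 1%g; rewrite conjg1. Qed.

(** The zeros of [b] in the kernel form a closed subgroup, stable under conjugation since [b] is
    invariant there; so it contains all conjugates of the relators. *)
Lemma additive_along_relators0 b : loc_const b ->
    additive_along (hom_kernel pi) b ->
  (forall i, b (r i) = 0) -> forall y, hom_kernel pi y -> b y = 0.
Proof.
have [piM _ _ _] := piP; move=> bl ba br0.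
have [bR bL] := ba; have b1 := additive_along1 piP ba.
suff : topgen (Defs.conjugates r) `<=` [set y | hom_kernel pi y /\ b y = 0].
  by move=> sub y; rewrite {1}piK => /sub[].
apply: topgen_min.
- split=> /= [|y z [Ny by0] [Nz bz]|y [Ny by0]].
  + by split; [exact: open_epi1|].
  + by split; [rewrite /hom_kernel /= piM Ny Nz mulg1|rewrite bR // by0 bz
      addr0].
  + split; first by rewrite /hom_kernel /= open_epiV // Ny invg1.
    by rewrite (additive_alongV piP ba Ny) by0 oppr0.
- apply: closedI; first by rewrite [X in closed X]piK; exact: topgen_closed.
  by have [] := loc_const_clopen [set 0] bl.
- move=> _ [i [g ->]]; split.
    by rewrite piK; apply: topgen_sub; exists i, g.
  have Nrg : hom_kernel pi (r i ^ g)%g.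
    by rewrite piK; apply: topgen_sub; exists i, g.
  have := bL g (r i) (Nr i); rewrite conjgC bR // br0 add0r =>
    /(canRL (addKr _)).
  by rewrite addNr.
Qed.

Definition dual_basis (i : 'I_n) : F -> 'F_p :=
  sval (cid2 (free_chom pP Fx (fun k => (i == k)%:R))).

Lemma dual_basis_chom i : chom (dual_basis i).
Proof. by rewrite /dual_basis; case: cid2. Qed.

Lemma dual_basisE i k : dual_basis i (x k) = (i == k)%:R.
Proof. by rewrite /dual_basis; case: cid2. Qed.

Definition relation_matrix : 'M['F_p]_n := \matrix_(i, j) dual_basis i (r j).
Local Notation A := relation_matrix.

Lemma chom_combination (u : 'rV['F_p]_n) :
    chom (fun y => \sum_i u 0 i * dual_basis i y).
Proof.
split=> [y|y z].
  have : \forall z \near y, forall i, dual_basis i z = dual_basis i y.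
    by apply: filter_forall => i; have [+ _] := dual_basis_chom i; exact.
  by apply: filterS => z e; apply: eq_bigr => i _; rewrite e.
by rewrite -big_split; apply: eq_bigr => i _; have [_ ->] := dual_basis_chom i;
  rewrite mulrDr.
Qed.

Lemma chom_on_relators h : chom h -> \row_j h (r j) = (\row_i h (x i)) *m A.
Proof.
move=> hP; have hE : h = fun y => \sum_i (\row_i h (x i)) 0 i * dual_basis i y.
  apply: (free_chom_eq pP Fx hP (chom_combination _)) => k.
  rewrite (bigD1 k) //= dual_basisE eqxx mulr1 mxE big1 ?addr0 // => i ik.
  by rewrite dual_basisE (negPf ik) mulr0.
apply/rowP => j; rewrite !mxE {1}hE; apply: eq_bigr => i _.
by rewrite !mxE.
Qed.

(** A character is recorded by its values u at the generators, and it descends to G exactly when its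
    values u A at the relators vanish. *)
Lemma presented_cohom1 : has_dim (cohom p G 1) (n - \rank A).
Proof.
have [piM pic piS piO] := piP.
have [||M [ME dM]] := @cohom1_has_dim p G n (fun b : G -> 'F_p =>
  \row_i b (pi (x i))).
- by move=> a b h _ _; apply/rowP => i; rewrite !mxE.
- move=> b bP /rowP e; apply/funext => y; have [z <-] := piS y.
  have c0 : chom (0 : F -> 'F_p) by split;
    [exact: loc_const_cst|move=> *; rewrite addr0].
  have := free_chom_eq pP Fx (chom_inflate piP bP) c0.
  by move=> /(_ _)/(congr1 (@^~ z)); apply=> i; have := e i; rewrite !mxE.
suff <- : \rank M = (n - \rank A)%N by [].
rewrite -mxrank_ker; apply/eqP; rewrite eqn_leq; apply/andP; split; apply:
  mxrankS; apply/rV_subP => u.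
  move=> /ME[b bP <-]; apply/sub_kermxP.
  have := chom_on_relators (chom_inflate piP bP); rewrite /= => <-.
  have b1 := chom1 bP.
  by apply/rowP => j; rewrite !mxE /= (_ : pi (r j) = 1%g) //; exact: Nr.
move=> /sub_kermxP uA; apply/ME.
have hP := chom_combination u; set h := fun y => _ in hP.
have hx : \row_i h (x i) = u.
  apply/rowP => k; rewrite mxE /h (bigD1 k) //= dual_basisE eqxx mulr1 big1
    ?addr0 // => i ik.
  by rewrite dual_basisE (negPf ik) mulr0.
have hr i : h (r i) = 0.
  have := chom_on_relators hP; rewrite hx uA => /rowP/(_ i); by rewrite !mxE.
have [hl hM] := hP.
have ha : additive_along (hom_kernel pi) h by split=> *; rewrite hM.
have h0 := additive_along_relators0 hl ha hr.
have [s sK] := open_epi_section piP.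
have hE y : h (s (pi y)) = h y.
  have Ny : hom_kernel pi (y^-1 * s (pi y))%g by apply/(hom_kernelP piP);
    rewrite sK.
  by rewrite -[s (pi y)](mulVKg y) hM (h0 _ Ny) addr0.
exists (h \o s); last by rewrite -hx; apply/rowP => i; rewrite !mxE /= hE.
split.
  apply: (loc_const_descend piP); rewrite (_ : _ \o _ = h) //.
  by apply/funext => y; rewrite /= hE.
move=> y z; have [y' <-] := piS y; have [z' <-] := piS z.
by rewrite -piM /= !hE hM.
Qed.

Lemma trivializes_ex c : cocycle2 c -> exists b, trivializes pi c b.
Proof.
have [piM pic piS piO] := piP; move=> [cl cP].
have [|b [bl cb _]] := @free_cocycle_lift p n F x pP Fx
  (fun y z => c (pi y) (pi z) - c 1%g 1%g) (fun=> 0).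
  split; last by rewrite open_epi1 // subrr.
  split=> [|y z w]; last by rewrite !piM -[RHS](cP (pi y) (pi z) (pi w)); ring.
  have pl : continuous (fun z : F * F => (pi z.1, pi z.2)).
    move=> z; have p1 : continuous_at z (fun z : F * F => pi z.1).
      by apply: (@continuous_comp _ _ _ fst pi); [exact: cvg_fst|exact: pic].
    have p2 : continuous_at z (fun z : F * F => pi z.2).
      by apply: (@continuous_comp _ _ _ snd pi); [exact: cvg_snd|exact: pic].
    exact: (cvg_pair p1 p2).
  have cpl := loc_const_comp pl cl.
  exact: (loc_const_map2 (fun s _ : 'F_p => s - c 1%g 1%g) cpl cpl).
by exists b; split=> // y z; rewrite cb.
Qed.

Lemma trivializes_relators_uniq c b b' : trivializes pi c b ->
    trivializes pi c b' ->
  (\row_j b (r j) - \row_j b' (r j) <= A)%MS.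
Proof.
move=> cb cb'; rewrite (_ : _ - _ = \row_j (b (r j) - b' (r j))).
  by rewrite (chom_on_relators (trivializes_uniq cb cb')) submxMl.
by apply/rowP => j; rewrite !mxE.
Qed.

(** Values in the row space of [A] are those of a character; subtracting it makes [b] vanish on the
    kernel. Conversely a coboundary has a trivialization vanishing at the relators, and any two
    differ by a character. *)
Lemma trivializes_relators_coboundary c b : cocycle2 c -> trivializes pi c b ->
  (\row_j b (r j) <= A)%MS <-> coboundary2 c.
Proof.
move=> cP cb; split=> [/submxP[v bv]|[f fl cf]].
  pose h y := \sum_i v 0 i * dual_basis i y.
  have hP : chom h := chom_combination v.
  have hx : \row_i h (x i) = v.
    apply/rowP => k; rewrite mxE /h (bigD1 k) //= dual_basisE eqxx mulr1 big1
      ?addr0 // => i ik.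
    by rewrite dual_basisE (negPf ik) mulr0.
  have cbh := trivializes_chom cb hP.
  apply: (trivializes_kernel0 piP cP cbh).
  apply: additive_along_relators0 (trivializes_additive cP cbh) _;
    first by case: cbh.
  move=> j; have := chom_on_relators hP; rewrite hx -bv => /rowP/(_ j).
  by rewrite !mxE => ->; rewrite subrr.
have cE : c = fun u v => f u + f v - f (u * v)%g by apply/funext => u;
  apply/funext => v; exact: cf.
have := trivializes_relators_uniq cb; rewrite cE =>
  /(_ _ (trivializes_coboundary piP fl)).
rewrite (_ : _ - _ = \row_j b (r j)) //; apply/rowP => j; rewrite !mxE.
by rewrite (_ : pi (r j) = 1%g) ?subrr ?subr0 //; exact: Nr.
Qed.

(** The chosen trivialization [B c] need not be linear in c, but its values at the relators are
    linear modulo the row space of [A]. Multiplying by [cokermx A] takes that quotient, and the rank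
    of this matrix is n - rank A. *)
Lemma presented_cohom2 : exists2 m,
    has_dim (cohom p G 2) m & (m <= n - \rank A)%N.
Proof.
pose B c := if pselect (cocycle2 c) is left cP then sval
  (cid (trivializes_ex cP)) else 0.
have BP c : cocycle2 c -> trivializes pi c (B c).
  by move=> cP; rewrite /B; case: pselect => // cP'; case: cid.
pose T c : 'rV['F_p]_n := (\row_j B c (r j)) *m cokermx A.
have [||M [ME dM]] := @cohom2_has_dim p G n T.
- move=> a c d cP dP; apply/eqP;
    rewrite /T scalemxAl -mulmxDl -subr_eq0 -mulmxBl.
  rewrite -submxE (_ : a *: _ + _ = \row_j (a * B c (r j) + B d (r j))).
    exact: trivializes_relators_uniq (BP _ (cocycle2_linear a cP dP))
      (trivializes_linear a (BP _ cP) (BP _ dP)).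
  by apply/rowP => j; rewrite !mxE.
- move=> c cP; rewrite -(trivializes_relators_coboundary cP (BP _ cP)) submxE.
  by split=> /eqP.
exists (\rank M) => //; rewrite -mxrank_coker; apply: mxrankS.
by apply/rV_subP => u /ME[c _ <-]; exact: submxMl.
Qed.

Lemma presented_sigma1 : sigma_acts_by_opp p G 1.
Proof.
have [piM pic piS piO] := piP.
apply/sigma_acts_by_opp1P => b bP y; have [z <-] := piS y.
have [bpl bpM] := chom_inflate piP bP.
have b1 : b (pi 1%g) = 0 := chom1 (chom_inflate piP bP).
have cs : chom (fun z => b (pi (sigma z))).
  by split=> [|u v]; [exact:
    (loc_const_comp (@sigma_continuous F) bpl)|rewrite sigmaM; exact: bpM].
have cN : chom (fun z => - b (pi z)).
  split=> [|u v]; first exact: (loc_const_map2 (fun s _ => - s) bpl bpl).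
  by rewrite [b (pi _)]bpM opprD.
have := free_chom_eq pP Fx cs cN.
rewrite -pis => /(_ _)/(congr1 (@^~ z)); apply=> i; rewrite sx; apply/eqP.
by rewrite -addr_eq0 -[b _ + b _]bpM mulVg /= b1.
Qed.

Lemma presented_sigma2 : sigma_acts_by_opp p G 2.
Proof.
apply/sigma_acts_by_opp2P => c cP; have [b cb] := trivializes_ex cP.
have sc : continuous (fun z : G * G => (sigma z.1, sigma z.2)).
  move=> z; have s1 : continuous_at z (fun z : G * G => sigma z.1).
    by apply: (@continuous_comp _ _ _ fst sigma);
      [exact: cvg_fst|exact: sigma_continuous].
  have s2 : continuous_at z (fun z : G * G => sigma z.2).
    by apply: (@continuous_comp _ _ _ snd sigma);
      [exact: cvg_snd|exact: sigma_continuous].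
  exact: (cvg_pair s1 s2).
have csP : cocycle2 (fun u v => c (sigma u) (sigma v)).
  have [cl cc] := cP; split; first exact: (loc_const_comp sc cl).
  by move=> u v w; rewrite !sigmaM cc.
have csb : trivializes pi (fun u v => c (sigma u) (sigma v)) (fun y =>
  b (sigma y)).
  have [bl cbE] := cb; split; first exact:
    (loc_const_comp (@sigma_continuous F) bl).
  by move=> y z; rewrite sigma1 -!pis cbE sigmaM.
have sum1 (T U : Type) (f g : T -> U -> 'F_p) :
  (fun u v => f u v + g u v) = fun u v => 1 * f u v + g u v.
  by apply/funext => u; apply/funext => v; rewrite mul1r.
rewrite sum1; have cD := cocycle2_linear 1 csP cP.
have cDb := trivializes_linear 1 csb cb.
(* The sum of [b] and its twist by sigma is a trivialization; it vanishes at each relator because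
   sigma inverts the relator and [b] is a homomorphism on the kernel. *)
apply/(trivializes_relators_coboundary cD cDb).
rewrite (_ : \row_j _ = 0) ?sub0mx //; apply/rowP => j; rewrite !mxE mul1r sr.
by rewrite (additive_alongV piP (trivializes_additive cP cb) (Nr j)) addNr.
Qed.

End PresentationCohomology.

Lemma presented_cohom_condition (p : nat) (G : sigmaGroupType) : prime p ->
  (exists n, sigma_presented p n G) -> cohom_condition p G.
Proof.
move=> pP [n /sigma_presentedP[F [x [r [pi pres]]]]].
have d1 := presented_cohom1 pP pres; have [m d2 le_m] :=
  presented_cohom2 pP pres.
split; [by eexists; exact: d1|by exists m| |exact:
  (presented_sigma1 pP pres)|exact: (presented_sigma2 pP pres)].
by rewrite (dimE d1) (dimE d2).
Qed.

(** * Presentations from cohomology *)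

Section CompactEpimorphism.
Variables (F G : topGroupType) (pi : F -> G).
Hypotheses (cF : compact [set: F]) (hG : hausdorff_space G).
Hypotheses (piM : {morph pi : x y / (x * y)%g}) (pic : continuous pi).

Lemma compact_image_subgroup : is_subgroup (range pi) /\ closed (range pi).
Proof.
have pi1 := morph_one piM.
have piV x := morph_inv x piM.
split; first split=> [|_ _ [x _ <-] [y _ <-]|_ [x _ <-]].
- by exists 1%g.
- by exists (x * y)%g.
- by exists (x^-1)%g.
- apply: compact_closed => //; apply: continuous_compact => //.
  exact: continuous_subspaceT.
Qed.

(** The saturation of an open set under the kernel is open, so the image of its complement is
    compact, hence closed. *)
Lemma compact_open_epi : (forall y, exists x, pi x = y) -> open_epi pi.
Proof.
move=> piS; split=> // x A; rewrite nbhsE => -[U [oU Ux] UA].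
have pi1 := morph_one piM.
have piV y := morph_inv y piM.
pose sat := [set y | exists2 u, U u & pi u = pi y].
have osat : open sat.
  rewrite openE => y [u Uu uy].
  have nU : nbhs (1 * y * (y^-1 * u))%g U.
    by rewrite mul1g mulVKg; exact: open_nbhs_nbhs.
  apply: (@filterS _ (nbhs y)) (mulg_cont1 nU) => z /= Uz.
  by exists (1 * z * (y^-1 * u))%g => //; rewrite mul1g !piM piV uy mulVg mulg1.
have cC : closed (pi @` (~` sat)).
  apply: compact_closed => //; apply: continuous_compact.
    exact: continuous_subspaceT.
  by apply: (subclosed_compact _ cF) => //; exact: open_closedC.
rewrite nbhsE; exists (~` (pi @` (~` sat))).
  split; first exact: closed_openC.
  by move=> [z nz zx]; apply: nz; exists x.
move=> y ny; have [z zy] := piS y.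
have : sat z by apply: contrapT => nz; apply: ny; exists z.
by move=> [u Uu uz]; exists u; [exact: UA|rewrite uz].
Qed.

End CompactEpimorphism.

Section CohomologyPresentation.
Variables (p : nat) (G : sigmaGroupType).
Hypotheses (pP : prime p) (p_gt2 : (2 < p)%N) (Gp : pro_p p G).

Let double_eq0 (a : 'F_p) : a + a = 0 -> a = 0.
Proof.
move=> /eqP; rewrite -mulr2n -mulr_natr mulf_eq0 => /orP[/eqP //|].
rewrite -(dvdn_pcharf (pchar_Fp pP)) => /(dvdn_leq (ltn0Sn 1)).
by rewrite leqNgt p_gt2.
Qed.

Let minus_commutator (H : sigmaGroupType) (h : H) :
  minus_part (h * (sigma h)^-1)%g.
Proof. by rewrite /minus_part /= sigmaM sigmaV sigmaK invgM invgK. Qed.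

(** Separating points of G are pushed into the minus part; every character doubles its value there,
    so with p odd they still separate. *)
Lemma dual_generators d : has_dim (cohom p G 1) d -> sigma_acts_by_opp p G 1 ->
  exists g : 'I_d -> G, (forall i, minus_part (g i)) /\
    forall b : G -> 'F_p, chom b -> (forall i, b (g i) = 0) -> b = 0.
Proof.
move=> /cohom1_coordinates[T [TD T0 TS]] /sigma_acts_by_opp1P opp.
have c0 : chom (0 : G -> 'F_p) by split;
  [exact: loc_const_cst|move=> *; rewrite addr0].
have [|||||s [sd _ sP]] :=
  @separating_points _ (G -> ('F_p)^o) G (fun x b => b x) setT d
  (fun b => chom (b : G -> 'F_p)) T.
- by [].
- exact: c0.
- move=> a u v [ul uM] [vl vM]; split; first exact:
    (loc_const_map2 (fun s t : 'F_p => a * s + t) ul vl).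
  move=> y z; transitivity (a * u (y * z)%g + v (y * z)%g) => //.
  by rewrite uM vM; transitivity (a * u y + v y + (a * u z + v z)) => //; ring.
- by move=> a u v cu cv; exact: TD.
- by move=> u cu /(T0 _ cu) -> y _.
(* The list may be shorter than d and is padded with 1. *)
pose g0 i := nth 1%g s i.
exists (fun i : 'I_d => g0 i * (sigma (g0 i))^-1)%g; split=> [i|b cb bg].
  exact: minus_commutator.
apply/funext => y; apply: (sP b cb) => // i x0 si;
  rewrite (set_nth_default 1%g) //.
have := bg (Ordinal (leq_trans si sd)) => /=; have [_ bM] := cb.
by rewrite bM (chomV _ cb) opp // opprK; exact: double_eq0.
Qed.

Lemma cohom_condition_presented d m :
    has_dim (cohom p G 1) d -> has_dim (cohom p G 2) m -> (m <= d)%N ->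
    sigma_acts_by_opp p G 1 -> sigma_acts_by_opp p G 2 ->
  sigma_presented p d G.
Proof.
move=> d1 d2 md opp1 opp2.
have [g [gm gP]] := dual_generators d1 opp1.
have [F [x [Fx sx]]] := free_pro_p_sigma d pP.
have [Fp Fu] := Fx; have [cF hF _ _] := Fp; have [_ hG _ _] := Gp.
have [pi [[pic piM pix] _]] := Fu G g Gp.
have [gR cR] := compact_image_subgroup cF hG piM pic.
(* A nonzero character trivial on the closed image would vanish at all the [g i]. *)
have piS y : exists z, pi z = y.
  apply: contrapT => ny; have [|b [bP bR [z]]] :=
    pro_p_frattini pP Gp gR cR (x := y).
    by move=> [z _ zy]; apply: ny; exists z.
  by rewrite (gP b bP) ?eqxx // => i; rewrite -pix; apply: bR; exists (x i).
have piP := compact_open_epi cF hG piM pic piS.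
(* Both composites send [x i] to the inverse of [g i], so uniqueness identifies them. *)
have pis : {morph pi : y / sigma y}.
  have [j [_ jU]] := Fu G (fun i => (g i)^-1)%g Gp.
  have e : pi \o sigma = sigma \o pi.
    rewrite -(jU (pi \o sigma)) ?(jU (sigma \o pi)) //.
    - split=> [y|y z|i]; [|by rewrite /= piM sigmaM|by rewrite /= pix gm].
      by apply: (@continuous_comp _ _ _ pi sigma);
        [exact: pic|exact: sigma_continuous].
    - split=> [y|y z|i]; [|by rewrite /= sigmaM piM|by rewrite /= sx
        (open_epiV piP) pix].
      by apply: (@continuous_comp _ _ _ sigma pi);
        [exact: sigma_continuous|exact: pic].
  by move=> y; have := congr1 (@^~ y) e.
(* Minimality of the presentation: evaluating characters of G at the d generators is an injective
   self-map of the finite set F_p^d, hence onto. *)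
have inflated (h : F -> 'F_p) : chom h -> exists2 b : G ->
  'F_p, chom b & h = b \o pi.
  move=> hP; have [T [TD T0 TS]] := cohom1_coordinates d1.
  pose psi u := sval (cid2 (TS u)).
  have psiP u : chom (psi u) by rewrite /psi; case: cid2.
  have psiK u : T (psi u) = u by rewrite /psi; case: cid2.
  pose ev u : 'rV['F_p]_d := \row_i psi u (g i).
  have evI : injective ev.
    move=> u v /rowP uv; have [ul uM] := psiP u; have [vl vM] := psiP v.
    have uvP : chom (fun y => psi u y - psi v y).
      split; first exact: (loc_const_map2 (fun s t : 'F_p => s - t) ul vl).
      by move=> y z; rewrite uM vM; ring.
    rewrite -(psiK u) -(psiK v); congr T; apply/funext => y; apply/eqP;
      rewrite -subr_eq0.
    apply/eqP; have := gP _ uvP _ => /(_ _)/(congr1 (@^~ y)); apply => i.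
    by have := uv i; rewrite !mxE => ->; rewrite subrr.
  have [ev' _ evK] := injF_bij evI.
  exists (psi (ev' (\row_i h (x i)))) => //.
  apply: (free_chom_eq pP Fx hP); first exact: (chom_inflate piP).
  move=> i /=; rewrite pix; have /rowP/(_ i) := evK (\row_i h (x i)).
  by rewrite !mxE => ->.
have [T [TD T0]] := cohom2_coordinates d2.
have [t tP] := transgression p piP.
pose W (b : F -> ('F_p)^o) :=
  loc_const (b : F -> 'F_p) /\ additive_along (hom_kernel pi) (b : F -> 'F_p).
have tZ b : W b -> cocycle2 (t b).
  by move=> [bl ba]; apply: (cocycle2_descend piP bl); exact: tP.
have WD a b h : W b -> W h -> W (a *: b + h).
  move=> [bl [br bL]] [hl [hr hL]]; split; first exact:
    (loc_const_map2 (fun s t : 'F_p => a * s + t) bl hl).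
  split=> y n Nn; [transitivity (a * b (y * n)%g + h (y * n)%g)|transitivity
    (a * b (n * y)%g + h (n * y)%g)] => //.
    rewrite br // hr //; transitivity (a * b y + h y + (a * b n + h n)) => //;
      ring.
  rewrite bL // hL //; transitivity (a * b n + h n + (a * b y + h y)) => //;
    ring.
have tD a b h : W b -> W h -> t (a *: b + h) = fun u v => a * t b u v + t h u v.
  move=> Wb Wh; apply/funext => u; apply/funext => v.
  have [y <-] := piS u; have [z <-] := piS v.
  have [_ ba] := Wb; have [_ ha] := Wh; have [_ bha] := WD a _ _ Wb Wh.
  rewrite !tP //.
  transitivity (a * b y + h y +
    (a * b z + h z) - (a * b (y * z)%g + h (y * z)%g)) => //; ring.
(* If the transgression is the coboundary of f, then b minus the inflation of f is a character of F,
   hence inflated. So b is constant on the kernel, with value b(1) = 0. *)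
have TI b : W b -> T (t b) = 0 -> forall n, hom_kernel pi n -> b n = 0.
  move=> Wb /(T0 _ (tZ _ Wb)) [f fl fE] n Nn; have [bl ba] := Wb.
  have fpl := loc_const_comp pic fl.
  have [|h hP bE] := inflated (fun y => b y - f (pi y)).
    split; first exact: (loc_const_map2 (fun s t : 'F_p => s - t) bl fpl).
    move=> y z; have := tP b ba y z; rewrite fE -piM => e.
    apply/eqP; rewrite -subr_eq0; apply/eqP.
    by move/eqP: e; rewrite -subr_eq0 => /eqP e; rewrite -[RHS]e; ring.
  have b1 := additive_along1 piP ba.
  have := congr1 (@^~ n) bE; have := congr1 (@^~ 1%g) bE;
    rewrite /= Nn (open_epi1 piP) b1 => <-.
  by move=> /(canRL (subrK _)) ->; rewrite subrK.
have [|||||s [sd sN sP]] :=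
  @separating_points _ (F ->
    ('F_p)^o) F (fun y b => b y) (hom_kernel pi) m W (T \o t).
- by [].
- split; first exact: loc_const_cst.
  by split=> *; rewrite addr0.
- by move=> a b h; exact: WD.
- by move=> a b h Wb Wh; rewrite /= tD // TD //; exact: tZ.
- exact: TI.
pose n0 i := nth 1%g s i.
have Nn0 i : hom_kernel pi (n0 i).
  rewrite /n0; have [si|si] := ltnP i (size s); first exact: sN.
  by rewrite nth_default //; exact: open_epi1.
have Ns n : hom_kernel pi n -> hom_kernel pi (sigma n).
  by move=> Nn; rewrite /hom_kernel /= pis Nn sigma1.
(* Since sigma acts by -1 on H^2, the sum of b and its twist has trivial transgression, and
   injectivity makes it vanish on the kernel. *)
have sb b n : W b -> hom_kernel pi n -> b (sigma n) = - b n.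
  move=> Wb Nn; have [bl [br bL]] := Wb.
  have Wbs : W (b \o sigma).
    split; first exact: (loc_const_comp (@sigma_continuous F) bl).
    by split=> y k Nk; rewrite /= sigmaM; [apply: br|apply: bL]; exact: Ns.
  have := TI (1 *: (b \o sigma : F -> ('F_p)^o) + b) (WD 1 _ _ Wbs Wb) _ n Nn.
  have -> : T (t (1 *: (b \o sigma : F -> ('F_p)^o) + b)) = 0.
    rewrite tD // T0; last by apply: cocycle2_linear; exact: tZ.
    have := (sigma_acts_by_opp2P p G).1 opp2 _ (tZ _ Wb).
    congr coboundary2; apply/funext => u; apply/funext => v; rewrite mul1r;
      congr (_ + _).
    have [y <-] := piS u; have [z <-] := piS v.
    have [_ ba] := Wb; have [_ bsa] := Wbs.
    by rewrite -!pis (tP _ bsa) (tP _ ba) /= sigmaM.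
  move=> /(_ erefl) e; apply/eqP; rewrite -addr_eq0; apply/eqP; rewrite -[RHS]e.
  by transitivity (1 * b (sigma n) + b n) => //; rewrite mul1r.
(* There are at most m separating points and m <= d, so all of them are covered; the remaining
   relators are 1. *)
pose r (i : 'I_d) := (n0 i * (sigma (n0 i))^-1)%g.
have rm i : minus_part (r i) by exact: minus_commutator.
have Nr i : hom_kernel pi (r i).
  by rewrite /hom_kernel /= piM (open_epiV piP) (Nn0 i) (Ns _ (Nn0 i)) mulgV.
have gN : is_subgroup (hom_kernel pi).
  split=> [|y z Ny Nz|y Ny]; first exact: open_epi1.
    by rewrite /hom_kernel /= piM Ny Nz mulg1.
  by rewrite /hom_kernel /= (open_epiV piP) Ny invg1.
have jN y z : hom_kernel pi y -> hom_kernel pi (y ^ z)%g.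
  by move=> Ny; rewrite /hom_kernel /= conjgE !piM (open_epiV piP) Ny mul1g
    mulVg.
pose N := NormalSubgroup gN jN.
have MN : topgen (Defs.conjugates r) `<=` hom_kernel pi.
  apply: topgen_min => //; last by move=> _ [i [z ->]]; exact:
    (jN (r i) z (Nr i)).
  apply: (@preimage_closed _ _ pi [set 1%g]) => [y _|]; first exact: pic.
  exact: accessible_closed_set1 (hausdorff_accessible hG) _.
apply/sigma_presentedP; exists F, x, r, pi; split=> //; split=> //.
(* Were the kernel larger than the normal closure, some b in [W] would vanish on the closure but not
   on the kernel. At each relator its value is 2 b(n0 i), so it would vanish at all separating
   points and therefore on the kernel. *)
apply/seteqP; split=> // y Ny; apply: contrapT => nMy.
have [b [bl ba bM [k Nk /eqP]]] :=
  @pro_p_additive_along p F pP Fp (Defs.normal_closure r) N y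
  (@topgen_closed _ _) MN Ny nMy.
have Wb : W b by [].
apply; apply: (sP b Wb) Nk => i x0 si; rewrite (set_nth_default 1%g) //.
have := bM _ (topgen_sub (ex_intro _ (Ordinal (leq_trans si (leq_trans sd md)))
  (ex_intro _ 1%g (esym (conjg1 _))))).
have [br _] := ba; have [_ _ NV] := gN; rewrite (br _ _ (NV _ (Ns _ (Nn0 i)))).
rewrite (additive_alongV piP ba (Ns _ (Nn0 i))) sb // opprK.
exact: double_eq0.
Qed.

End CohomologyPresentation.

Theorem proposition7p7 (p : nat) (p_prime : prime p) (p_gt2 : (2 < p)%N)
    (G : sigmaGroupType) (G_pro_p : pro_p p G) :
  ((exists n : nat, sigma_presented p n G) <-> cohom_condition p G) /\
  ((exists n : nat, sigma_presented p n G) -> sigma_presented p (d_G p G) G).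
Proof.
have ab := presented_cohom_condition (G := G) p_prime.
have ba : cohom_condition p G -> sigma_presented p (d_G p G) G.
  move=> [[d d1] [m d2] md opp1 opp2].
  rewrite /d_G (dimE d1); apply: (cohom_condition_presented p_prime p_gt2 G_pro_p d1 d2) => //.
  by rewrite -(dimE d1) -(dimE d2).
split; first split=> [|/ba presG]; first exact: ab.
  by exists (d_G p G).
by move=> /ab/ba.
Qed.
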